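(* Let $B$ be a real symmetric positive definite $n\times n$ matrix, and consider the flat torus $\mathbb{T}^n=\mathbb{R}^n/\mathbb{Z}^n$ with the metric $(x,y)_B=\langle Bx,y\rangle$. Let $\mathcal{V}$ be a finite set of vectors in $\mathbb{R}^n$ such that $Bv\in\mathbb{Z}^n$ for every $v\in\mathcal{V}$ and $v+w\neq0$ for all $v,w\in\mathcal{V}$. Let $\{a_v\}_{v\in\mathcal{V}}$ be a uniformly random point of the sphere of radius $\sqrt2$ in $\mathbb{R}^{\mathcal{V}}$, and define the random function $$f(x)=\mathrm{Re}\left(\sum_{v\in\mathcal{V}}a_v e^{2\pi i\langle Bv,x\rangle}\right).$$ Let $\mu_v=(2\pi\|v\|_B)^2$ where $\|v\|_B^2=(v,v)_B$. Let $X$ be a uniformly random point of $\mathbb{T}^n$ (independent of the $a_v$) and $Z$ a standard Gaussian random variable. Then for every $\mu>0$, $$\mathbb{E}\,d_{TV}(f(X),Z)\le\frac{1}{\mu}\left[\sqrt{\frac{8(2\pi)^4}{|\mathcal{V}|(|\mathcal{V}|+2)}\sum_{v,w\in\mathcal{V}}(v,w)_B^2}+\left(2\sqrt2+\sqrt\pi\right)\sqrt{\frac{1}{|\mathcal{V}|}\sum_{v\in\mathcal{V}}(\mu_v-\mu)^2}\right],$$ where $d_{TV}(f(X),Z)$ is computed for fixed coefficients $\{a_v\}$ and the expectation is over the random coefficients.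
   Context: $d_{TV}(X,Y)=\sup_A|\mathbb{P}(X\in A)-\mathbb{P}(Y\in A)|$ over measurable $A$. With the metric $(\cdot,\cdot)_B$, the Laplacian on the torus is $\Delta_Bf=\sum_{j,k}(B^{-1})_{jk}\partial_j\partial_kf$, and $e^{2\pi i\langle Bv,x\rangle}$ (for $Bv\in\mathbb{Z}^n$) has eigenvalue $-\mu_v$. *)

(* Defs.v *)
From HB Require Import structures.
From mathcomp Require Import all_boot all_order all_algebra.
From mathcomp Require Import all_classical all_reals all_analysis.
Set Implicit Arguments. Unset Strict Implicit. Unset Printing Implicit Defensive.
Import Order.TTheory GRing.Theory Num.Theory.
Import numFieldTopology.Exports.
Local Open Scope classical_set_scope.
Local Open Scope ring_scope.

Section Defs.
Variable R : realType.

(** Points of R^k are represented by sequences [x : nat -> R] of which only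
    the coordinates [0 .. k-1] are relevant. *)
Definition ncons (t : R) (x : nat -> R) : nat -> R :=
  fun i => if i is j.+1 then x j else t.

(** Iterated Lebesgue integral over the cube [a,b]^k of a function
    g : R^k -> \bar R (i.e. the integral w.r.t. k-dimensional Lebesgue
    measure restricted to the cube, by Tonelli for nonnegative g). *)
Fixpoint cube_int (a b : R) (k : nat) (g : (nat -> R) -> \bar R) : \bar R :=
  match k with
  | 0 => g (fun _ => 0)
  | k'.+1 => (\int[@lebesgue_measure R]_(t in `[a, b]) cube_int a b k' (fun x => g (ncons t x)))%E
  end.

(** Uniform probability on the torus T^n = R^n/Z^n, identified with the
    fundamental domain [0,1]^n: P(X in S) for S a set of points. *)
Definition torus_prob (n : nat) (S : set (nat -> R)) : \bar R :=
  cube_int 0 1 n (fun x => (\1_S x)%:E).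

Definition eucl_norm (k : nat) (x : nat -> R) : R :=
  Num.sqrt (\sum_(i < k) x i ^+ 2).

(** Expectation of h(a) for a uniformly distributed on the sphere of radius r
    in R^k, defined through normalized surface measure = normalized cone
    measure:  E[h] = (1/lambda(B)) \int_B h(r x/|x|) dx, B the unit ball. *)
Definition sphere_expect (k : nat) (r : R) (h : (nat -> R) -> \bar R) : \bar R :=
  (cube_int (-1) 1 k
     (fun x => (\1_[set y | eucl_norm k y <= 1] x)%:E *
               h (fun i => (r * x i / eucl_norm k x)%R))
   * (fine (cube_int (-1) 1 k
        (fun x => (\1_[set y | eucl_norm k y <= 1] x)%:E)))^-1%:E)%E.

Definition dTV (P Q : set R -> \bar R) : \bar R :=
  ereal_sup [set `|P A - Q A|%E | A in [set A : set R | measurable A]].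

Definition innerB (n : nat) (B : 'M[R]_n) (v w : 'rV[R]_n) : R :=
  (v *m B *m w^T) 0 0.

Definition pairB (n : nat) (B : 'M[R]_n) (v : 'rV[R]_n) (x : nat -> R) : R :=
  \sum_(i < n) (v *m B) 0 i * x i.

(** f(x) = Re (sum_j a_j e^{2 pi i <B v_j, x>}) with real a_j. *)
Definition randf (n : nat) (B : 'M[R]_n) (V : seq 'rV[R]_n) (a : nat -> R)
  (x : nat -> R) : R :=
  \sum_(j < size V) a j * cos (2 * pi * pairB B V`_j x).

Definition eigB (n : nat) (B : 'M[R]_n) (v : 'rV[R]_n) : R :=
  (2 * pi) ^+ 2 * innerB B v v.

End Defs.

(* Main.v *)
Require Import Defs.
From HB Require Import structures.
From mathcomp Require Import all_boot all_order all_algebra.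
From mathcomp Require Import all_classical all_reals all_analysis.
From mathcomp Require Import measurable_realfun ring lra.
Import Order.TTheory GRing.Theory Num.Theory.
Import numFieldNormedType.Exports.
Local Open Scope classical_set_scope.
Local Open Scope ring_scope.

(** For fixed coefficients [a] the eigenfunction sum [f] satisfies, by
    integration by parts on the torus,
    [E g'(f) |grad f|^2 = E g(f) (- Laplacian f)]. Taking for [g] the solution of
    Stein's equation for a test function [h], which has [|g|, |g'| <= 2], gives
    [mu * |E h(f) - E h(Z)| <= 2 E | |grad f|^2 - mu | + 2 E |Laplacian f + mu f|];
    it suffices to do this for continuous [h] with values in [[0, 1]], since these
    approximate the indicators of Borel sets in L^1 of (law of f + Gaussian).
    The two error terms are controlled by second moments: over the torus by
    orthogonality of the characters, over the sphere by
    [E a_i a_j a_l a_m = 4 / (k (k + 2)) * (d_ij d_lm + d_il d_jm + d_im d_jl)].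
    In place of Jensen's inequality we use [2 |y| <= y^2 / c + c] and optimize
    over [c] at the end, so that only expectations of polynomials occur. *)

(** The total variation distance is a supremum over all Borel sets, and its measurability in [a] is
    not obvious. The sphere expectation is therefore bounded by monotonicity, comparing the distance
    with an explicit measurable majorant that depends on the products [a_i a_j] only. A uniform
    point of the sphere is sqrt 2 x / |x| for x in the unit ball, and the origin is sent to 0. The
    majorant has to hold there as well, so |a|^2 = 2 is replaced by a defect |1 - |a|^2 / 2|, which
    integrates to 0. Cube integrals give direct access to coordinates, not to rotations; the moments
    of the sphere come from integration by parts along chords of the ball. Origin of the constants,
    with k = |V|, S = 2 (2 pi)^4 / (k (k + 2)) sum (v,w)_B^2 and T = (1/k) sum (mu_v - mu)^2: the
    fluctuation of |grad f|^2 contributes 2 sqrt S, which is the first root of the bound. The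
    Laplacian term and the distance from mu to the mean of |grad f|^2 share one parameter and
    contribute 4 sqrt T, where 4 <= 2 sqrt 2 + sqrt pi. *)

(** * Iterated integrals over cubes *)

Section CubeIntegral.
Variable R : realType.
Notation mu := (@lebesgue_measure R).
Notation ncons := Defs.ncons.
Implicit Types (a b : R) (k : nat).

(** Tested against all measurable parametrizations [p], [u] of the arguments, so that in an
    induction over coordinates the integrated variable can join the parameter by substitution. *)
Definition jointly_measurable {d d'} {T : measurableType d}
    {S : measurableType d'} (G : T -> (nat -> R) -> S) : Prop :=
  forall d1 (T1 : measurableType d1) (p : T1 -> T) (u : nat -> T1 -> R),
    measurable_fun setT p -> (forall i, measurable_fun setT (u i)) ->
    measurable_fun setT (fun t => G (p t) (fun i => u i t)).

(** Tonelli gives measurability for the positive and the negative part separately, and the integral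
    is by definition their difference; hence no sign or integrability condition. *)
Lemma measurable_param_integral {d} {T : measurableType d} (D : set R)
    (f : T * measurableTypeR R -> \bar R) :
  measurable D -> measurable_fun setT f ->
  measurable_fun setT (fun t => \int[mu]_(s in D) f (t, s))%E.
Proof.
move=> mD mf.
have mfD : measurable_fun setT (fun p : T * measurableTypeR R => (f \_ (setT `*` D)) p).
  apply/(measurable_restrictT _ _).1; first exact: measurableX.
  exact: measurable_funTS.
have -> : (fun t => \int[mu]_(s in D) f (t, s))%E =
          (fun t => \int[mu]_s (f \_ (setT `*` D))^\+ (t, s) -
                    \int[mu]_s (f \_ (setT `*` D))^\- (t, s))%E.
  apply/funext => t; rewrite integral_mkcond integralE; congr (_ - _)%E;
    apply: eq_integral => s _; rewrite !(funeposE, funenegE) !patchE/= ?in_setX;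
    by rewrite /= in_setT.
apply: emeasurable_funB.
- exact: (@measurable_fun_fubini_tonelli_F _ _ T (measurableTypeR R) R mu _
    (measurable_funepos mfD)).
- exact: (@measurable_fun_fubini_tonelli_F _ _ T (measurableTypeR R) R mu _
    (measurable_funeneg mfD)).
Qed.

Lemma measurable_cube_int a b k {d} {T : measurableType d}
    (G : T -> (nat -> R) -> \bar R) :
  jointly_measurable G -> measurable_fun setT (fun t => cube_int a b k (G t)).
Proof.
elim: k d T G => [|k IH] d T G mG /=.
  by apply: (mG _ _ id (fun _ _ => 0)).
(* The first cube coordinate becomes part of the parameter space, which is why [T] varies in the
   induction. *)
pose H (p : T * measurableTypeR R) := cube_int a b k (fun x => G p.1 (ncons p.2 x)).
apply: (measurable_param_integral _ H) => //.
apply: (IH _ _ (fun p x => G p.1 (ncons p.2 x))) => d1 T1 p u mp mu_.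
apply: (mG _ _ (fun t => (p t).1) (fun i t => ncons (p t).2 (u^~ t) i)).
  exact: measurableT_comp.
by case => [|i] /=; [exact: measurableT_comp|exact: mu_].
Qed.

Definition incube a b k (x : nat -> R) := forall i, (i < k)%N -> a <= x i <= b.

(* Equivalent to measurability for the product sigma-algebra on [nat -> R], but
   directly stable under partial integration by Fubini-Tonelli. *)
Definition meas_coord {d} {S : measurableType d} (g : (nat -> R) -> S) : Prop :=
  forall d1 (T1 : measurableType d1) (u : nat -> T1 -> R),
    (forall i, measurable_fun setT (u i)) ->
    measurable_fun setT (fun t => g (fun i => u i t)).

Lemma meas_coord_ncons {d} {S : measurableType d} (g : (nat -> R) -> S) :
  meas_coord g -> jointly_measurable (fun (t : R) x => g (ncons t x)).
Proof.
move=> mg d1 T1 p u mp mu_.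
by apply: (mg _ _ (fun i t => ncons (p t) (u^~ t) i)); case => /=.
Qed.

(** Boundedness is required on the cube only, so that coordinates and polynomials belong to the
    class. *)
Definition bounded_meas a b k (g : (nat -> R) -> R) : Prop :=
  meas_coord g /\ exists M, forall x, incube a b k x -> `|g x| <= M.

Definition rint a b k (g : (nat -> R) -> R) : R :=
  fine (cube_int a b k (fun x => (g x)%:E)).

Lemma incube_ncons a b k t x :
  a <= t <= b -> incube a b k x -> incube a b k.+1 (ncons t x).
Proof. by move=> tab xc [|i] //= ik; exact: xc. Qed.

Lemma bounded_meas_ncons a b k g t : a <= t <= b ->
  bounded_meas a b k.+1 g -> bounded_meas a b k (fun x => g (ncons t x)).
Proof.
move=> tab [mg [M gM]]; split.
  move=> d1 T1 u mu_.
  exact: (meas_coord_ncons _ mg _ _ (fun _ => t) u).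
by exists M => x xc; apply/gM/incube_ncons.
Qed.

Lemma measurable_rint a b k g : meas_coord g ->
  measurable_fun setT (fun t => rint a b k (fun x => g (ncons t x))).
Proof.
move=> mg; apply: measurableT_comp => //.
apply: (measurable_cube_int _ _ _ (fun t x => (g (ncons t x))%:E)).
move=> d1 T1 p u mp mu_; apply/measurable_EFinP.
exact: (meas_coord_ncons _ mg _ _ p u).
Qed.

Lemma integrable_bounded_itv a b (f : R -> R) M : measurable_fun setT f ->
  (forall t, a <= t <= b -> `|f t| <= M) ->
  mu.-integrable `[a, b] (EFin \o f).
Proof.
move=> mf fM; apply: measurable_bounded_integrable => //.
- by rewrite /= lebesgue_measure_itv/=; case: ifP => _; rewrite ?ltry.
- exact: measurable_funTS.
- exists M; split; first exact: num_real.
  move=> r Mr t /=; rewrite in_itv/= => /fM tM.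
  exact: le_trans tM (ltW Mr).
Qed.

Lemma le_normr_Rintegral_itv a b (f : R -> R) M : a <= b ->
  measurable_fun setT f -> (forall t, a <= t <= b -> `|f t| <= M) ->
  `|\int[mu]_(t in `[a, b]) f t| <= M * (b - a).
Proof.
move=> ab mf fM; have If := integrable_bounded_itv _ _ _ _ mf fM.
apply: le_trans (le_normr_Rintegral _ _) _ => //.
have -> : M * (b - a) = \int[mu]_(t in `[a, b]) (cst M) t.
  rewrite /cst Rintegral_cst//= lebesgue_measure_itv/= lte_fin.
  by case: ltgtP ab => //= -> _; rewrite subrr ?mulr0.
apply: le_Rintegral => //.
- apply: (integrable_bounded_itv _ _ _ M) => [|t /fM].
    exact: measurableT_comp.
  by rewrite normr_id.
- exact: (integrable_bounded_itv _ _ _ `|M|).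
Qed.

(** Finiteness and bound go together in the induction: the integral over the first coordinate is
    finite because the bound on the slices makes its integrand bounded. *)
Lemma cube_int_fin_bound a b k (g : (nat -> R) -> R) M : a <= b -> meas_coord g ->
  (forall x, incube a b k x -> `|g x| <= M) ->
  cube_int a b k (fun x => (g x)%:E) = (rint a b k g)%:E /\
  `|rint a b k g| <= M * (b - a) ^+ k.
Proof.
move=> ab; elim: k g => [|k IH] g mg gM.
  by split => //; rewrite /rint/= expr0 mulr1 gM.
have E t : a <= t <= b -> cube_int a b k (fun x => (g (ncons t x))%:E) =
    (rint a b k (fun x => g (ncons t x)))%:E /\
    `|rint a b k (fun x => g (ncons t x))| <= M * (b - a) ^+ k.
  move=> tab; apply: IH => [|x xc]; last exact/gM/incube_ncons.
  move=> d1 T1 u mu_.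
  exact: (meas_coord_ncons _ mg _ _ (fun _ => t) u).
have E' : cube_int a b k.+1 (fun x => (g x)%:E) =
    (\int[mu]_(t in `[a, b]) (rint a b k (fun x => g (ncons t x)))%:E)%E.
  by apply: eq_integral => t; rewrite inE/= in_itv/= => /E[].
have mr := measurable_rint a b k g mg.
have bd t (tab : a <= t <= b) := (E t tab).2.
split.
  rewrite /rint E' fineK//; apply: integrable_fin_num => //.
  exact: integrable_bounded_itv mr bd.
rewrite /rint E' exprSr mulrA.
exact: le_normr_Rintegral_itv.
Qed.

Section nondegenerate.
Variables a b : R.
Hypothesis ab : a <= b.
Notation bmeas k g := (bounded_meas a b k g).
Notation I := (rint a b).

Lemma cube_int_rint k g : bmeas k g -> cube_int a b k (fun x => (g x)%:E) = (I k g)%:E.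
Proof. by move=> [mg [M gM]]; have [] := cube_int_fin_bound _ _ _ _ M ab mg gM. Qed.

Lemma normr_rint_le k (g : (nat -> R) -> R) M : meas_coord g ->
  (forall x, incube a b k x -> `|g x| <= M) -> `|I k g| <= M * (b - a) ^+ k.
Proof. by move=> mg gM; have [] := cube_int_fin_bound _ _ _ _ M ab mg gM. Qed.

Lemma integrable_rint k g : bmeas k.+1 g ->
  mu.-integrable `[a, b] (EFin \o (fun t => I k (fun x => g (ncons t x)))).
Proof.
move=> gn; have [mg [M gM]] := gn.
apply: (integrable_bounded_itv _ _ _ (M * (b - a) ^+ k)).
  exact: measurable_rint.
move=> t tab; have [mg' _] := bounded_meas_ncons _ _ _ _ _ tab gn.
by apply: normr_rint_le => // x xc; apply/gM/incube_ncons.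
Qed.

Lemma rintS k g : bmeas k.+1 g ->
  I k.+1 g = \int[mu]_(t in `[a, b]) I k (fun x => g (ncons t x)).
Proof.
move=> gn; rewrite /rint /Rintegral; congr fine.
apply: eq_integral => t; rewrite inE/= in_itv/= => tab.
exact/cube_int_rint/bounded_meas_ncons.
Qed.

Lemma eq_rint k g h : (forall x, incube a b k x -> g x = h x) -> I k g = I k h.
Proof.
move=> gh; rewrite /rint; congr fine.
elim: k g h gh => [|k IH] g h gh /=; first by rewrite gh.
apply: eq_integral => t; rewrite inE/= in_itv/= => tab.
by apply: IH => x xc; apply/gh/incube_ncons.
Qed.

Lemma meas_coordD (g h : (nat -> R) -> R) : meas_coord g -> meas_coord h -> meas_coord (fun x => g x + h x).
Proof.
by move=> mg mh d T u mu_; apply: measurable_funD; [exact: mg|exact: mh].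
Qed.

Lemma meas_coordM (g h : (nat -> R) -> R) : meas_coord g -> meas_coord h -> meas_coord (fun x => g x * h x).
Proof.
by move=> mg mh d T u mu_; apply: measurable_funM; [exact: mg|exact: mh].
Qed.

Lemma meas_coord_comp {d} {S : measurableType d} (g : (nat -> R) -> R) (f : R -> S) :
  measurable_fun setT f -> meas_coord g -> meas_coord (fun x => f (g x)).
Proof.
by move=> mf mg d1 T u mu_; apply: measurableT_comp => //; exact: mg.
Qed.

Lemma bmeas_cst k c : bmeas k (fun=> c).
Proof. by split; [move=> d T u _; exact: measurable_cst|exists `|c|]. Qed.

Lemma bmeas_coord k i : (i < k)%N -> bmeas k (fun x => x i).
Proof.
move=> ik; split; first by move=> d T u; exact.
exists (`|a| + `|b|) => x /(_ i ik)/andP[ax xb].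
rewrite ler_norml; apply/andP; split.
  rewrite (le_trans _ ax)// lerNl (le_trans (ler_norm _))// normrN lerDl//.
by rewrite (le_trans xb)// (le_trans (ler_norm _))// lerDr.
Qed.

Lemma bmeasD k g h : bmeas k g -> bmeas k h -> bmeas k (fun x => g x + h x).
Proof.
move=> [mg [M gM]] [mh [N hN]]; split; first exact: meas_coordD.
by exists (M + N) => x xc; rewrite (le_trans (ler_normD _ _))// lerD ?gM ?hN.
Qed.

Lemma bmeasM k g h : bmeas k g -> bmeas k h -> bmeas k (fun x => g x * h x).
Proof.
move=> [mg [M gM]] [mh [N hN]]; split; first exact: meas_coordM.
by exists (M * N) => x xc; rewrite normrM ler_pM ?gM ?hN.
Qed.

Lemma bmeasZ k c g : bmeas k g -> bmeas k (fun x => c * g x).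
Proof. by move=> gn; apply: bmeasM => //; exact: bmeas_cst. Qed.

Lemma bmeasB k g h : bmeas k g -> bmeas k h -> bmeas k (fun x => g x - h x).
Proof.
move=> gn /(bmeasZ _ (-1)) hn.
have -> : (fun x => g x - h x) = (fun x => g x + -1 * h x).
  by apply/funext => x; rewrite mulN1r.
exact: bmeasD.
Qed.

Lemma bmeasX k m g : bmeas k g -> bmeas k (fun x => g x ^+ m).
Proof.
move=> gn; elim: m => [|m IH].
  rewrite (_ : (fun x => _) = fun=> 1); first exact: bmeas_cst.
  by apply/funext => x; rewrite expr0.
rewrite (_ : (fun x => _) = fun x => g x * g x ^+ m); first exact: bmeasM.
by apply/funext => x; rewrite exprS.
Qed.

Lemma bmeas_sum k (J : Type) (r : seq J) (P : pred J) (g : J -> (nat -> R) -> R) :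
  (forall j, P j -> bmeas k (g j)) -> bmeas k (fun x => \sum_(j <- r | P j) g j x).
Proof.
move=> gn; elim: r => [|j r IH].
  rewrite (_ : (fun x => _) = fun=> 0); first exact: bmeas_cst.
  by apply/funext => x; rewrite big_nil.
have [Pj|Pj] := boolP (P j); last first.
  rewrite (_ : (fun x => _) = fun x => \sum_(j <- r | P j) g j x) //.
  by apply/funext => x; rewrite big_cons (negbTE Pj).
rewrite (_ : (fun x => _) = fun x => g j x + \sum_(j <- r | P j) g j x).
  by apply: bmeasD => //; exact: gn.
by apply/funext => x; rewrite big_cons Pj.
Qed.

Lemma bmeas_comp k (f : R -> R) g M : measurable_fun setT f ->
  (forall y, `|f y| <= M) -> bmeas k g -> bmeas k (fun x => f (g x)).
Proof. by move=> mf fM [mg _]; split; [exact: meas_coord_comp|exists M]. Qed.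

Lemma rintD k g h : bmeas k g -> bmeas k h -> I k (fun x => g x + h x) = I k g + I k h.
Proof.
elim: k g h => [|k IH] g h gn hn; first by [].
rewrite !rintS//; last exact: bmeasD.
rewrite -RintegralD//; [|exact: integrable_rint|exact: integrable_rint].
apply: eq_Rintegral => t; rewrite inE/= in_itv/= => tab.
by rewrite IH//; exact: bounded_meas_ncons.
Qed.

Lemma rintZ k c g : bmeas k g -> I k (fun x => c * g x) = c * I k g.
Proof.
elim: k g => [|k IH] g gn; first by [].
rewrite !rintS//; last exact: bmeasZ.
rewrite -RintegralZl//; last exact: integrable_rint.
apply: eq_Rintegral => t; rewrite inE/= in_itv/= => tab.
by rewrite IH//; exact: bounded_meas_ncons.
Qed.

Lemma rint_cst0 k : I k (fun=> 0) = 0.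
Proof.
rewrite -[RHS](mul0r (I k (fun=> 0))) -rintZ; last exact: bmeas_cst.
by apply: eq_rint => x _; rewrite mul0r.
Qed.

Lemma rintB k g h : bmeas k g -> bmeas k h -> I k (fun x => g x - h x) = I k g - I k h.
Proof.
move=> gn hn; rewrite -[- I k h]mulN1r -rintZ// -rintD//; last exact: bmeasZ.
by apply: eq_rint => x _; rewrite mulN1r.
Qed.

Lemma rint_sum k (J : Type) (r : seq J) (P : pred J) (g : J -> (nat -> R) -> R) :
  (forall j, P j -> bmeas k (g j)) ->
  I k (fun x => \sum_(j <- r | P j) g j x) = \sum_(j <- r | P j) I k (g j).
Proof.
move=> gn; elim: r => [|j r IH].
  by rewrite big_nil -[RHS](rint_cst0 k); apply: eq_rint => x _; rewrite big_nil.
rewrite big_cons; have [Pj|Pj] := boolP (P j); last first.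
  by rewrite -IH; apply: eq_rint => x _; rewrite big_cons (negbTE Pj).
rewrite -IH -rintD; [|exact: gn|exact: bmeas_sum].
by apply: eq_rint => x _; rewrite big_cons Pj.
Qed.

Lemma rint_ge0 k g : (forall x, incube a b k x -> 0 <= g x) -> 0 <= I k g.
Proof.
move=> g0; rewrite fine_ge0//.
elim: k g g0 => [|k IH] g g0 /=; first by rewrite lee_fin g0.
apply: integral_ge0 => t /=; rewrite in_itv/= => tab.
by apply: IH => x xc; apply/g0/incube_ncons.
Qed.

Lemma le_rint k g h : bmeas k g -> bmeas k h ->
  (forall x, incube a b k x -> g x <= h x) -> I k g <= I k h.
Proof.
move=> gn hn gh; rewrite -subr_ge0 -rintB//; apply: rint_ge0 => x xc.
by rewrite subr_ge0 gh.
Qed.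

Lemma rint_cst k c : I k (fun=> c) = c * (b - a) ^+ k.
Proof.
elim: k => [|k IH]; first by rewrite expr0 mulr1.
rewrite rintS; last exact: bmeas_cst.
rewrite IH Rintegral_cst//= lebesgue_measure_itv/= lte_fin exprSr mulrA.
by case: ltgtP ab => //= -> _; rewrite subrr ?mulr0.
Qed.

Let D : set R := `[a, b]%classic.

Lemma meas_coord_Rintegral (g : (nat -> R) -> R) : meas_coord g ->
  meas_coord (fun x => \int[mu]_(t in D) g (ncons t x)).
Proof.
move=> mg d T u mu_; apply: measurableT_comp => //.
apply: (measurable_param_integral _ (fun p : T * measurableTypeR R =>
  (g (ncons p.2 (fun i => u i p.1)))%:E)).
  exact: measurable_itv.
apply/measurable_EFinP.
apply: (mg _ _ (fun i (p : T * measurableTypeR R) =>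
  ncons p.2 (fun i => u i p.1) i)).
by case => [|i] //=; exact: measurableT_comp.
Qed.

Lemma meas_coord_slice (g : (nat -> R) -> R) x :
  meas_coord g -> measurable_fun setT (fun t : R => g (ncons t x)).
Proof.
move=> mg; apply: (mg _ _ (fun i t => ncons t x i)).
by case => //= i; exact: measurable_cst.
Qed.

Lemma bmeas_Rintegral k g : bmeas k.+1 g ->
  bmeas k (fun x => \int[mu]_(t in D) g (ncons t x)).
Proof.
move=> [mg [M gM]]; split; first exact: meas_coord_Rintegral.
exists (M * (b - a)) => x xc.
apply: le_normr_Rintegral_itv => // [|t tab]; first exact: meas_coord_slice.
exact/gM/incube_ncons.
Qed.

(** Extension by 0 outside the square [D * D] turns both iterated integrals into integrals over the
    plane, where Fubini applies since a bounded function on a set of finite measure is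
    integrable. *)
Lemma Rintegral_swap (f : measurableTypeR R * measurableTypeR R -> R) M :
  measurable_fun setT f ->
  (forall s t, D s -> D t -> `|f (s, t)| <= M) ->
  \int[mu]_(s in D) \int[mu]_(t in D) f (s, t) =
  \int[mu]_(t in D) \int[mu]_(s in D) f (s, t).
Proof.
move=> mf fM.
have mD : measurable D by exact: measurable_itv.
have Dfin : (mu D < +oo)%E.
  by rewrite /= lebesgue_measure_itv/=; case: ifP => _; rewrite ?ltry.
have iF : (mu \x mu)%E.-integrable (D `*` D) (EFin \o f).
  apply: measurable_bounded_integrable.
  - exact: measurableX.
  - rewrite [ltLHS](_ : _ = (mu D * mu D)%E); last exact: product_measure1E.
    by rewrite lte_mul_pinfty// ge0_fin_numE.
  - exact: measurable_funTS.
  - exists M; split; first exact: num_real.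
    move=> r Mr [s t] /= [Ds Dt].
    exact: le_trans (fM _ _ Ds Dt) (ltW Mr).
have iF' : (mu \x mu)%E.-integrable setT ((EFin \o f) \_ (D `*` D)).
  by apply: (integrable_mkcond _ _).1 => //; exact: measurableX.
have := Fubini iF'.
have slice1 s t : ((EFin \o f) \_ (D `*` D)) (s, t) =
    ((fun s => ((fun t => (f (s, t))%:E) \_ D) t) \_ D) s.
  by rewrite !patchE in_setX /=; case: (s \in D); case: (t \in D).
have slice2 s t : ((EFin \o f) \_ (D `*` D)) (s, t) =
    ((fun t => ((fun s => (f (s, t))%:E) \_ D) s) \_ D) t.
  by rewrite !patchE in_setX /=; case: (s \in D); case: (t \in D).
have ms s : measurable_fun setT (fun t : R => f (s, t)).
  by apply: measurableT_comp => //; exact: measurable_pair1.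
have mt t : measurable_fun setT (fun s : R => f (s, t)).
  by apply: measurableT_comp => //; exact: measurable_pair2.
have E1 : (\int[mu]_s \int[mu]_t ((EFin \o f) \_ (D `*` D)) (s, t) =
    \int[mu]_(s in D) (\int[mu]_(t in D) f (s, t))%R%:E)%E.
  rewrite [RHS]integral_mkcond; apply: eq_integral => s _.
  under eq_integral do rewrite slice1.
  rewrite patchE; case: ifPn => sD; last first.
    by rewrite integral0_eq// => t _; rewrite patchE (negbTE sD).
  under eq_integral do rewrite patchE sD.
  rewrite -integral_mkcond /Rintegral fineK//.
  apply: integrable_fin_num => //.
  apply: (integrable_bounded_itv _ _ _ M) => // t tab.
  by apply: fM; rewrite ?inE// in sD *.
have E2 : (\int[mu]_t \int[mu]_s ((EFin \o f) \_ (D `*` D)) (s, t) =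
    \int[mu]_(t in D) (\int[mu]_(s in D) f (s, t))%R%:E)%E.
  rewrite [RHS]integral_mkcond; apply: eq_integral => t _.
  under eq_integral do rewrite slice2.
  rewrite patchE; case: ifPn => tD; last first.
    by rewrite integral0_eq// => s _; rewrite patchE (negbTE tD).
  under eq_integral do rewrite patchE tD.
  rewrite -integral_mkcond /Rintegral fineK//.
  apply: integrable_fin_num => //.
  apply: (integrable_bounded_itv _ _ _ M) => // s sab.
  by apply: fM; rewrite ?inE// in tD *.
by rewrite E1 E2 => H; rewrite /Rintegral H.
Qed.

(** By induction the first coordinate moves past one further coordinate at a time: the two outermost
    integrals are exchanged, and the induction hypothesis treats the inner ones. *)
Lemma rint_swap k g : bmeas k.+1 g ->
  \int[mu]_(t in D) I k (fun x => g (ncons t x)) =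
  I k (fun x => \int[mu]_(t in D) g (ncons t x)).
Proof.
elim: k g => [|k IH] g gn //.
have [mg [M gM]] := gn.
(* [flip] exchanges the first two coordinates, so that freezing the second one at [s] gives a
   function to which the induction hypothesis applies. *)
pose flip (x : nat -> R) := ncons (x 1%N) (ncons (x 0%N) (fun i => x i.+2)).
have flipE s t x : flip (ncons s (ncons t x)) = ncons t (ncons s x) by [].
have mflip : meas_coord (fun x => g (flip x)).
  move=> d T u mu_.
  apply: (mg _ _ (fun i t => flip (fun i => u i t) i)).
  by case => [|[|i]] //=.
have gflip : bmeas k.+2 (fun x => g (flip x)).
  split => //; exists M => x xc; apply: gM.
  by case=> [|[|i]] ik; apply: xc.
rewrite rintS; last exact: bmeas_Rintegral.
under eq_Rintegral => t.
  rewrite inE /D/= in_itv/= => tab.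
  rewrite rintS; last exact: bounded_meas_ncons.
  over.
rewrite (Rintegral_swap (fun p => I k (fun x => g (ncons p.1 (ncons p.2 x))))
  (M * (b - a) ^+ k)).
- apply: eq_Rintegral => s; rewrite inE /D/= in_itv/= => sab.
  have := IH (fun x => g (flip (ncons s x))) (bounded_meas_ncons _ _ _ _ _ sab gflip).
  exact.
- apply: measurableT_comp => //.
  apply: (measurable_cube_int _ _ _ (fun (p : measurableTypeR R * measurableTypeR R) x =>
    (g (ncons p.1 (ncons p.2 x)))%:E)).
  move=> d1 T1 p u mp mu_; apply/measurable_EFinP.
  apply: (mg _ _ (fun i t => ncons (p t).1 (ncons (p t).2 (fun i => u i t)) i)).
  by case => [|[|i]] //=; exact: measurableT_comp.
- move=> s t; rewrite /D/= !in_itv/= => sab tab.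
  apply: normr_rint_le => [|x xc].
    have [] := bounded_meas_ncons _ _ _ _ _ tab
      (bounded_meas_ncons _ _ _ _ _ sab gn).
    by [].
  by apply: gM; do 2 apply: incube_ncons => //.
Qed.

Definition set_coord (x : nat -> R) (i : nat) (t : R) : nat -> R :=
  fun j => if j == i then t else x j.

(** The source of the vanishing integrals below: derivatives of functions with equal end values,
    nontrivial characters, and the indicator of the origin. *)
Lemma rint_coord_eq0 k g i : bmeas k g -> (i < k)%N ->
  (forall x, incube a b k x -> \int[mu]_(t in D) g (set_coord x i t) = 0) ->
  I k g = 0.
Proof.
elim: k g i => // k IH g [|i] gn ik g0; rewrite rintS//.
  rewrite rint_swap// -[RHS](rint_cst0 k); apply: eq_rint => x xc.
  (* The first coordinate is overwritten by [set_coord]; [a] is merely some point of the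
     interval. *)
  rewrite -[RHS](g0 (ncons a x)); last by apply: incube_ncons; rewrite ?lexx.
  apply: eq_Rintegral => t _; congr g.
  by apply/funext => -[|j].
rewrite -[RHS](Rintegral_set0 mu (fun=> 0)) Rintegral_mkcond [RHS]Rintegral_mkcond.
apply: eq_Rintegral => t _; rewrite !patchE in_set0; case: ifPn => //.
rewrite inE /D/= in_itv/= => tab.
apply: (IH _ i) => //; first exact: bounded_meas_ncons.
move=> x xc; rewrite -[RHS](g0 (ncons t x)); last exact: incube_ncons.
apply: eq_Rintegral => s _; congr g.
by apply/funext => -[|j].
Qed.

(** Dominated convergence one coordinate at a time; the constant bound on the slice integrals is the
    dominating function. *)
Lemma rint_cvg0 k (g : nat -> (nat -> R) -> R) M :
  (forall m, meas_coord (g m)) ->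
  (forall m x, incube a b k x -> `|g m x| <= M) ->
  (forall x, incube a b k x -> g m x @[m --> \oo] --> 0) ->
  I k (g m) @[m --> \oo] --> 0.
Proof.
elim: k g M => [|k IH] g M mg gM g0; first exact: g0.
have gn m : bmeas k.+1 (g m) by split => //; exists M => x; exact: gM.
have gS m t : a <= t <= b -> bmeas k (fun x => g m (ncons t x)).
  by move=> tab; exact: bounded_meas_ncons.
rewrite (_ : (fun m => I k.+1 (g m)) = (fun m =>
    \int[mu]_(t in D) I k (fun x => g m (ncons t x)))); last first.
  by apply/funext => m; rewrite rintS.
have mD : measurable D by exact: measurable_itv.
have Dfin : (mu D < +oo)%E.
  by rewrite /= lebesgue_measure_itv/=; case: ifP => _; rewrite ?ltry.
have mr m := measurable_rint a b k _ (mg m).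
have bd m t : a <= t <= b ->
    `|I k (fun x => g m (ncons t x))| <= M * (b - a) ^+ k.
  move=> tab; apply: normr_rint_le => [|x xc].
    by case: (gS m t tab).
  exact/gM/incube_ncons.
have [] := @dominated_convergence _ _ _ mu D mD
  (fun m t => (I k (fun x => g m (ncons t x)))%:E) (cst 0%E)
  (cst (M * (b - a) ^+ k)%:E).
- by move=> m; apply: measurable_funTS; apply/measurable_EFinP; exact: mr.
- exact: measurable_cst.
- apply: aeW => t; rewrite /D/= in_itv/= => tab.
  apply: cvg_EFin; first exact: nearW.
  apply: (IH (fun m x => g m (ncons t x)) M).
  + by move=> m; case: (gS m t tab).
  + by move=> m x xc; apply: gM; exact: incube_ncons.
  + move=> x xc. have := g0 (ncons t x) (incube_ncons _ _ _ _ _ tab xc). exact.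
- exact: (integrable_bounded_itv _ _ (cst (M * (b - a) ^+ k)) `|M * (b - a) ^+ k|).
- by apply: aeW => t m; rewrite /D/= in_itv/= => tab; rewrite lee_fin bd.
move=> _ _; rewrite integral_cst// mul0e.
exact: fine_cvg.
Qed.

End nondegenerate.
End CubeIntegral.

(** * The fundamental theorem of calculus on an interval and on a half-line *)

Section OneDimensionalCalculus.
Variable R : realType.
Notation mu := (@lebesgue_measure R).

Lemma is_derive_continuous (f : R -> R) (x y : R) :
  is_derive x 1 f y -> {for x, continuous f}.
Proof.
by move=> [df _]; apply: differentiable_continuous; exact/derivable1_diffP.
Qed.

(** The degenerate interval is included because a chord of the ball may shrink to a point. *)
Lemma Rintegral_FTC (F f : R -> R) (a b : R) : a <= b ->
  (forall t, a <= t <= b -> is_derive t 1 F (f t)) ->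
  (forall t, a <= t <= b -> {for t, continuous f}) ->
  \int[mu]_(t in `[a, b]) f t = F b - F a.
Proof.
rewrite le_eqVlt => /predU1P[<- _ _|ab dF cf].
  by rewrite set_itv1 Rintegral_set1 subrr.
rewrite /Rintegral (@continuous_FTC2 _ f F)//.
- apply: continuous_in_subspaceT => t; rewrite inE/= in_itv/=; exact: cf.
- split.
  + move=> t; rewrite in_itv/= => /andP[at_ tb].
    have tab : a <= t <= b by rewrite !ltW.
    by have [] := dF t tab.
  + apply: cvg_at_right_filter; apply: is_derive_continuous; apply: dF.
    by rewrite lexx ltW.
  + apply: cvg_at_left_filter; apply: is_derive_continuous; apply: dF.
    by rewrite lexx ltW.
- move=> t; rewrite in_itv/= => /andP[at_ tb].
  have tab : a <= t <= b by rewrite !ltW.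
  by rewrite derive1E; have [_ ->] := dF t tab.
Qed.

Lemma is_derive_Rintegral_Ny (f : R -> R) (x : R) : continuous f ->
  mu.-integrable setT (EFin \o f) ->
  is_derive x 1 (fun y => \int[mu]_(t in `]-oo, y]) f t) (f x).
Proof.
move=> cf If.
have xx1 : x < x + 1 by rewrite ltrDl.
have If' : mu.-integrable `]-oo, (x + 1)] (EFin \o f) by apply: integrableS If.
have [dF F'] := continuous_FTC1 xx1 If' (ltNyr _) (cf x).
by split => //; rewrite -derive1E.
Qed.

End OneDimensionalCalculus.

(** * Gaussian tail estimates and the bounded solution of Stein's equation *)

Section Stein.
Variable R : realType.
Notation mu := (@lebesgue_measure R).
Notation phi := (normal_pdf (0 : R) 1).

Lemma normal_pdf01E x : phi x = normal_peak 1 * expR (- (x ^+ 2 / 2)).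
Proof.
rewrite normal_pdfE ?oner_neq0// /normal_fun.
by rewrite subr0 expr1n mulNr -[1 *+ 2]/(2%:R).
Qed.

Lemma normal_pdf01_gt0 x : 0 < phi x.
Proof. by rewrite normal_pdf01E mulr_gt0 ?expR_gt0// normal_peak_gt0// oner_neq0. Qed.

Lemma is_derive_normal_pdf01 (x : R) : is_derive x 1 phi (- x * phi x).
Proof.
rewrite (_ : phi = fun x => normal_peak 1 * expR (- (x ^+ 2 / 2))); last first.
  by apply/funext => y; rewrite normal_pdf01E.
rewrite /=.
have d1 : is_derive x 1 (fun y : R => - (y ^+ 2 / 2)) (- x).
  rewrite (_ : (fun y : R => - (y ^+ 2 / 2)) = (fun y => (-2^-1) * (y * y))); last first.
    by apply/funext => y; rewrite expr2; field.
  apply: is_derive_eq.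
  rewrite /GRing.scale/=. by field.
have := @is_derive1_comp R expR (fun y => - (y ^+ 2 / 2)) x _ _ (is_derive_expR _) d1.
move=> d2; apply: is_derive_eq.
rewrite /GRing.scale/=; ring.
Qed.

Lemma continuous_normal_pdf01 : continuous phi.
Proof. by apply: continuous_normal_pdf; rewrite oner_neq0. Qed.

Lemma normal_pdf01_le x y : x ^+ 2 <= y ^+ 2 -> phi y <= phi x.
Proof.
move=> xy; rewrite !normal_pdf01E ler_wpM2l ?normal_peak_ge0// ler_expR.
by rewrite lerN2 ler_pM2r// invr_gt0.
Qed.

Lemma integrable_bounded_normal_pdf (f : R -> R) M : measurable_fun setT f ->
  (forall x, `|f x| <= M) ->
  mu.-integrable setT (EFin \o (fun x => f x * phi x)).
Proof.
move=> mf fM.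
apply: (@le_integrable _ _ _ mu setT measurableT _ (fun x => (M * phi x)%:E)).
- apply/measurable_EFinP; apply: measurable_funM => //.
  exact: measurable_normal_pdf.
- move=> x _ /=; rewrite lee_fin normrM [leRHS]normrM.
  by rewrite ler_wpM2r// (le_trans (fM x))// ler_norm.
- under eq_fun do rewrite EFinM.
  by apply: integrableZl => //; exact: integrable_normal_pdf.
Qed.

Let N y := \int[mu]_(t in `]-oo, y]) phi t.

Let iphi : mu.-integrable setT (EFin \o phi) := integrable_normal_pdf 0 1.

Lemma Rintegral_normal_pdf01 : \int[mu]_x phi x = 1.
Proof. by rewrite /Rintegral integral_normal_pdf. Qed.

Let N_ge0 y : 0 <= N y.
Proof. by apply: Rintegral_ge0 => x _; exact: normal_pdf_ge0. Qed.

Let N_le1 y : N y <= 1.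
Proof.
rewrite -Rintegral_normal_pdf01 -subr_ge0.
rewrite -set_itvNyy Rintegral_itvB ?bnd_simp//.
  by apply: Rintegral_ge0 => x _; exact: normal_pdf_ge0.
by rewrite set_itvNyy.
Qed.

Let N_derive (x : R) : is_derive x 1 N (phi x).
Proof. exact: is_derive_Rintegral_Ny continuous_normal_pdf01 iphi. Qed.

Let NB x y : x <= y -> N y - N x = \int[mu]_(t in `[x, y]) phi t.
Proof.
move=> xy; symmetry; apply: Rintegral_FTC => // t _.
exact: continuous_normal_pdf01.
Qed.

(** Continuity from below of the Gaussian measure along the intervals [[-m, m]]. It supplies the
    limit at infinity for tail estimates that are first proved on compact intervals. *)
Let N_tail (e : R) : 0 < e ->
  exists n : nat, forall m, (n <= m)%N -> 1 - e <= N m%:R - N (- m%:R).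
Proof.
move=> e0; pose F (m : nat) : set R := `[- m%:R, m%:R]%classic.
have FT : \bigcup_m F m = setT.
  apply/seteqP; split => // x _; exists (Num.truncn `|x|).+1 => //.
  have xt : `|x| <= (Num.truncn `|x|).+1%:R by exact/ltW/truncnS_gt.
  by rewrite /F/= in_itv/= -ler_norml.
have ndF : {homo F : n m / (n <= m)%N >-> (n <= m)%O}.
  move=> n m nm; apply/subsetPset => x; rewrite /F/= !in_itv/= => /andP[nx xn].
  have nm' : n%:R <= m%:R :> R by rewrite ler_nat.
  by rewrite (le_trans _ nx) ?(le_trans xn)// lerN2.
have := @nondecreasing_cvg_mu _ _ _ (normal_prob 0 1) F _ _ ndF.
rewrite FT => /(_ (fun=> measurable_itv _) measurableT).
rewrite [X in _ --> X -> _](_ : _ = 1%:E); last exact: probability_setT.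
move=> /fine_cvgP[_ /cvgrPdist_le/(_ e e0)[n _ nP]].
exists n => m nm; have /= := nP m nm.
rewrite NB; last by rewrite (@le_trans _ _ 0)// oppr_le0.
rewrite -/(F m) => /(le_trans (ler_norm _)).
by rewrite lerBlDr addrC -lerBlDr.
Qed.

Let intxphi x y : x <= y -> \int[mu]_(t in `[x, y]) (t * phi t) = phi x - phi y.
Proof.
move=> xy; transitivity (- phi y - (- phi x)); last ring.
apply: (Rintegral_FTC _ (fun t => - phi t)) => //.
- move=> t _; have d := is_derive_normal_pdf01 t.
  by apply: is_derive_eq; rewrite mulNr opprK.
- move=> t _; apply: cvgM; first exact: cvg_id.
  exact: continuous_normal_pdf01.
Qed.

Let int_itv (f : R -> R) x y : continuous f -> mu.-integrable `[x, y] (EFin \o f).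
Proof.
move=> cf; apply: continuous_compact_integrable; first exact: segment_compact.
exact: continuous_subspaceT.
Qed.

Let cvg_phi_mul (c : R) : continuous (fun t => c * phi t).
Proof.
move=> t; apply: cvgM; first exact: cvg_cst.
exact: continuous_normal_pdf01.
Qed.

Let cvg_t_phi : continuous (fun t : R => t * phi t).
Proof.
move=> t; apply: cvgM; first exact: cvg_id.
exact: continuous_normal_pdf01.
Qed.

(** On [[x, y]] the constant [x] is at most [t], and [t * phi t] has the antiderivative [- phi]. *)
Let mills_pre_r (x y : R) : x <= y -> x * (N y - N x) <= phi x.
Proof.
move=> xy; rewrite NB// -RintegralZl//; last exact/int_itv/continuous_normal_pdf01.
rewrite (@le_trans _ _ (phi x - phi y))//; last by rewrite gerBl normal_pdf_ge0.
rewrite -intxphi//; apply: le_Rintegral => //.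
- exact: int_itv.
- exact: int_itv.
- move=> t /=; rewrite in_itv/= => /andP[xt _].
  by rewrite ler_wpM2r// normal_pdf_ge0.
Qed.

Let mills_pre_l (x y : R) : y <= x -> - x * (N x - N y) <= phi x.
Proof.
move=> xy; rewrite NB// -RintegralZl//; last exact/int_itv/continuous_normal_pdf01.
rewrite (@le_trans _ _ (- (phi y - phi x)))//; last first.
  by rewrite opprB gerBl normal_pdf_ge0.
rewrite -intxphi// -mulN1r -RintegralZl//; last exact: int_itv.
apply: le_Rintegral => //.
- exact: int_itv.
- apply: int_itv => t; apply: cvgM; first exact: cvg_cst.
  exact: cvg_t_phi.
- move=> t /=; rewrite in_itv/= => /andP[_ tx].
  by rewrite mulrA mulN1r ler_wpM2r ?normal_pdf_ge0// lerN2.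
Qed.

Let far (x : R) n : exists2 m : nat, (n <= m)%N & `|x| <= m%:R.
Proof.
exists (maxn n (Num.truncn `|x|).+1); first exact: leq_maxl.
rewrite (le_trans (ltW (truncnS_gt _)))// ler_nat; exact: leq_maxr.
Qed.

Let mills_r (x : R) : 0 <= x -> x * (1 - N x) <= phi x.
Proof.
move=> x0; apply/ler_addgt0Pr => e e0.
have x1 : 0 < x + 1 by rewrite ltr_wpDl.
(* Dividing by [x + 1] instead of [x] keeps the loss [x * (e / (x + 1))] below [e] and also covers
   [x = 0]. *)
have [n nP] := N_tail (e / (x + 1)) (divr_gt0 e0 x1).
have [m /nP NP] := far x n; rewrite ger0_norm// => xm.
have := mills_pre_r x m%:R xm; have := N_ge0 (- m%:R).
have : x * (e / (x + 1)) <= e.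
  by rewrite mulrCA ger_pMr// ler_pdivrMr// mul1r lerDl.
by move: NP; set z := e / (x + 1); nra.
Qed.

Let mills_l (x : R) : x <= 0 -> - x * N x <= phi x.
Proof.
move=> x0; apply/ler_addgt0Pr => e e0.
have x1 : 0 < - x + 1 by rewrite ltr_wpDl// oppr_ge0.
have [n nP] := N_tail (e / (- x + 1)) (divr_gt0 e0 x1).
have [m /nP NP] := far x n; rewrite ler0_norm// lerNl => xm.
have := mills_pre_l x (- m%:R) xm; have := N_le1 m%:R.
have : - x * (e / (- x + 1)) <= e.
  by rewrite mulrCA ger_pMr// ler_pdivrMr// mul1r lerDl.
by move: NP; set z := e / (- x + 1); nra.
Qed.

Let NB_le (x y M : R) : x <= y -> (forall t, x <= t <= y -> phi t <= M) ->
  N y - N x <= M * (y - x).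
Proof.
move=> xy phiM; rewrite NB// (le_trans (ler_norm _))//.
apply: le_normr_Rintegral_itv => //; first exact: measurable_normal_pdf.
by move=> t /phiM; rewrite ger0_norm ?normal_pdf_ge0.
Qed.

(** From 1 on this is Mills' inequality. Before 1, the part up to 1 has mass at most
    [phi x * (1 - x)] and the rest at most [phi 1 <= phi x]. The 2 becomes the bound on the Stein
    solution. *)
Let tail_r (x : R) : 0 <= x -> 1 - N x <= 2 * phi x.
Proof.
move=> x0; have p0 := normal_pdf01_gt0 x; have [x1|x1] := leP 1 x.
  have := mills_r x x0; have := N_le1 x; nra.
have : N 1 - N x <= phi x * (1 - x).
  apply: NB_le => [|t /andP[xt _]]; first exact: ltW.
  by apply: normal_pdf01_le; rewrite ler_pXn2r// nnegrE// (le_trans x0).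
have : phi 1 <= phi x.
  by apply: normal_pdf01_le; rewrite ler_pXn2r// ?nnegrE// ltW.
have := mills_r 1 ler01; nra.
Qed.

Let tail_l (x : R) : x <= 0 -> N x <= 2 * phi x.
Proof.
move=> x0; have p0 := normal_pdf01_gt0 x; have [x1|x1] := leP x (-1).
  have := mills_l x x0; have := N_ge0 x; nra.
have : N x - N (-1) <= phi x * (x - (-1)).
  apply: NB_le => [|t /andP[_ tx]]; first exact: ltW.
  by apply: normal_pdf01_le; nra.
have : phi (-1) <= phi x.
  by apply: normal_pdf01_le; nra.
have := mills_l (-1) (lerN10 _); nra.
Qed.

(** Solution of [g' = x g + h - E h(Z)], namely
    [g x = (\int_(t <= x) (h t - E h(Z)) phi t) / phi x]. *)
Lemma stein_solution (h : R -> R) (c := \int[mu]_x (h x * phi x)) :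
  continuous h -> (forall x, 0 <= h x <= 1) ->
  exists g : R -> R,
    [/\ forall x : R, is_derive x 1 g (x * g x + (h x - c)),
        forall x, `|g x| <= 2 &
        forall x, `|x * g x + (h x - c)| <= 2].
Proof.
move=> ch h01.
have mh : measurable_fun setT h by exact: continuous_measurable_fun.
have h1 x : `|h x| <= 1 by have /andP[? ?] := h01 x; rewrite ger0_norm.
have ih := integrable_bounded_normal_pdf h 1 mh h1.
have c01 : 0 <= c <= 1.
  apply/andP; split.
    apply: Rintegral_ge0 => x _; rewrite mulr_ge0 ?normal_pdf_ge0//.
    by have /andP[] := h01 x.
  rewrite -Rintegral_normal_pdf01; apply: le_Rintegral => // x _.
  by rewrite ger_pMl ?normal_pdf01_gt0//; have /andP[] := h01 x.
pose H t := (h t - c) * phi t.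
have hc x : `|h x - c| <= 1.
  have /andP[? ?] := h01 x; have /andP[? ?] := c01.
  by rewrite ler_norml; apply/andP; split; lra.
have cH : continuous H.
  move=> t; apply: cvgM; last exact: continuous_normal_pdf01.
  by apply: cvgB; [exact: ch|exact: cvg_cst].
have iH : mu.-integrable setT (EFin \o H).
  apply: (integrable_bounded_normal_pdf _ 1) => //.
  by apply: measurable_funB => //; exact: measurable_cst.
have H0 : \int[mu]_t H t = 0.
  rewrite /H; under eq_Rintegral do rewrite mulrBl.
  rewrite RintegralB//; last first.
    apply: (integrable_bounded_normal_pdf (cst c) `|c|) => //.
  by rewrite RintegralZl// Rintegral_normal_pdf01 mulr1 subrr.
pose G x := \int[mu]_(t in `]-oo, x]) H t.
have dG (x : R) : is_derive x 1 G (H x) by exact: is_derive_Rintegral_Ny.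
have Hphi t : `|H t| <= phi t.
  rewrite normrM (ger0_norm (normal_pdf_ge0 _ _ _)).
  by rewrite ler_piMl ?normal_pdf_ge0.
have norm_int (A : set R) : measurable A ->
    `|\int[mu]_(t in A) H t| <= \int[mu]_(t in A) phi t.
  move=> mA; have iA : mu.-integrable A (EFin \o H) by exact: integrableS iH.
  rewrite (le_trans (le_normr_Rintegral _ iA))//.
  apply: le_Rintegral => //; last by exact: integrableS iphi.
  exact: (integrable_norm iA).
have G1 x : `|G x| <= N x by apply: norm_int; exact: measurable_itv.
(* Since [H] has integral 0, [G x] is also minus its integral over the upper half-line; the sign of
   [x] will decide which of the two tails is used. *)
have G2 x : `|G x| <= 1 - N x.
  have : \int[mu]_t H t - G x = \int[mu]_(t in `]x, +oo[) H t.
    by rewrite /G -set_itvNyy Rintegral_itvB ?bnd_simp// set_itvNyy.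
  rewrite H0 sub0r => GE; rewrite -normrN GE.
  apply: (le_trans (norm_int _ _)); first exact: measurable_itv.
  have -> : 1 - N x = \int[mu]_t phi t - N x by rewrite Rintegral_normal_pdf01.
  rewrite /N -set_itvNyy Rintegral_itvB ?bnd_simp//.
  by rewrite set_itvNyy.
pose g x := G x / phi x.
have phin0 x : phi x != 0 by rewrite gt_eqF// normal_pdf01_gt0.
have gb x : `|g x| <= 2.
  rewrite normrM normfV (ger0_norm (normal_pdf_ge0 _ _ _)).
  rewrite ler_pdivrMr ?normal_pdf01_gt0//.
  have [x0|x0] := leP 0 x.
    exact: le_trans (G2 x) (tail_r _ x0).
  exact: le_trans (G1 x) (tail_l _ (ltW x0)).
(* Mills' inequality bounds [x * g x] by 1; together with [hc] this yields the bound 2 on the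
   derivative. *)
have xgb x : `|x * g x| <= 1.
  rewrite mulrA normrM normfV (ger0_norm (normal_pdf_ge0 _ _ _)).
  rewrite ler_pdivrMr ?normal_pdf01_gt0// mul1r normrM.
  have [x0|x0] := leP 0 x.
    by rewrite ger0_norm// (le_trans _ (mills_r _ x0))// ler_wpM2l.
  rewrite ltr0_norm// (le_trans _ (mills_l _ (ltW x0)))// ler_wpM2l//.
  by rewrite oppr_ge0 ltW.
exists g; split => //; last first.
  move=> x; rewrite (le_trans (ler_normD _ _))// (le_trans (lerD (xgb x) (hc x)))//.
move=> x; have d1 := dG x; have d2 := is_derive_normal_pdf01 x.
have d3 := is_deriveV (phin0 x) d2.
rewrite (_ : g = G * (fun y => (phi y)^-1)); last exact/funext.
apply: is_derive_eq; rewrite /GRing.scale/= !fctE /H.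
by field; exact: phin0.
Qed.

End Stein.

(** * Approximation of Borel indicators by continuous functions *)

Section ContinuousApproximation.
Variable R : realType.
Implicit Types (psi : R -> R) (A : set R).

Definition bounded_mfun psi : Prop :=
  measurable_fun setT psi /\ exists M, forall x, `|psi x| <= M.

(** The last clause is a weak form of dominated convergence: each point is eventually a zero. The
    ramps for rays and the remainders of countable unions both converge in this way. *)
Definition positive_functional (L : (R -> R) -> R) : Prop :=
  [/\ forall psi1 psi2, bounded_mfun psi1 -> bounded_mfun psi2 ->
        (forall x, psi1 x <= psi2 x) -> L psi1 <= L psi2,
      forall psi1 psi2, bounded_mfun psi1 -> bounded_mfun psi2 ->
        L (fun x => psi1 x + psi2 x) = L psi1 + L psi2 &
      forall psi : nat -> R -> R, (forall m, measurable_fun setT (psi m)) ->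
        (forall m x, 0 <= psi m x <= 1) ->
        (forall x, exists n, forall m, (n <= m)%N -> psi m x = 0) ->
        L (psi m) @[m --> \oo] --> 0].

Definition continuous_approx (L : (R -> R) -> R) A : Prop :=
  forall e : R, 0 < e -> exists h : R -> R,
    [/\ continuous h, forall x, 0 <= h x <= 1 &
        L (fun x => `|\1_A x - h x|) <= e].

Lemma indic01 A x : 0 <= (\1_A x : R) <= 1.
Proof. by rewrite indicE; case: (x \in A); rewrite /= ?lexx ?ler01. Qed.

Lemma bounded_mfun_indic_dist A (h : R -> R) : measurable A -> continuous h ->
  (forall x, 0 <= h x <= 1) -> bounded_mfun (fun x => `|\1_A x - h x|).
Proof.
move=> mA ch h01; split.
  apply: measurableT_comp => //; apply: measurable_funB.
    exact: measurable_indic.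
  exact: continuous_measurable_fun.
exists 1 => x; rewrite normr_id ler_norml.
have /andP[? ?] := indic01 A x; have /andP[? ?] := h01 x.
by apply/andP; split; lra.
Qed.

Variable L : (R -> R) -> R.
Hypothesis HL : positive_functional L.
Let leL := let: And3 p _ _ := HL in p.
Let LD := let: And3 _ p _ := HL in p.
Let Lcvg := let: And3 _ _ p := HL in p.

Lemma bounded_mfunD psi1 psi2 : bounded_mfun psi1 -> bounded_mfun psi2 ->
  bounded_mfun (fun x => psi1 x + psi2 x).
Proof.
move=> [m1 [M1 b1]] [m2 [M2 b2]]; split; first exact: measurable_funD.
by exists (M1 + M2) => x; rewrite (le_trans (ler_normD _ _))// lerD.
Qed.

Let Lsmall (psi : nat -> R -> R) (e : R) : 0 < e ->
  (forall m, measurable_fun setT (psi m)) ->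
  (forall m x, 0 <= psi m x <= 1) ->
  (forall x, exists n, forall m, (n <= m)%N -> psi m x = 0) ->
  exists m, L (psi m) <= e.
Proof.
move=> e0 mpsi b c; have /cvgrPdist_le/(_ e e0)[n _ nP] := Lcvg _ mpsi b c.
exists n; have /= := nP n (leqnn n); rewrite sub0r normrN.
exact: le_trans (ler_norm _).
Qed.

Lemma continuous_approxC A : measurable A ->
  continuous_approx L A -> continuous_approx L (~` A).
Proof.
move=> mA aA e /aA[h [ch h01 Lh]]; exists (fun x => 1 - h x); split.
- by move=> x; apply: cvgB; [exact: cvg_cst|exact: ch].
- by move=> x; have /andP[? ?] := h01 x; apply/andP; split; lra.
- rewrite (_ : (fun x => _) = fun x => `|\1_A x - h x|)//.
  apply/funext => x; rewrite -[RHS]normrN; congr `|_|.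
  by rewrite !indicE in_setC; case: (x \in A) => /=; ring.
Qed.

(** The maximum works because the distance from the indicator of the union to [max h k] is pointwise
    at most the sum of the two given distances. *)
Lemma continuous_approxU A B : measurable A -> measurable B ->
  continuous_approx L A -> continuous_approx L B ->
  continuous_approx L (A `|` B).
Proof.
move=> mA mB aA aB e e0; have e2 : 0 < e / 2 by rewrite divr_gt0.
have [h [ch h01 Lh]] := aA _ e2; have [k [ck k01 Lk]] := aB _ e2.
have ckh : continuous (fun x => Num.max (h x) (k x)).
  by move=> x; apply: continuous_max; [exact: ch|exact: ck].
have kh01 x : 0 <= Num.max (h x) (k x) <= 1.
  have /andP[? ?] := h01 x; have /andP[? ?] := k01 x.
  by rewrite le_max ge_max; apply/andP; split; [apply/orP; left|apply/andP].
exists (fun x => Num.max (h x) (k x)); split => //.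
have bA := bounded_mfun_indic_dist _ _ mA ch h01.
have bB := bounded_mfun_indic_dist _ _ mB ck k01.
have -> : e = e / 2 + e / 2 by lra.
rewrite (le_trans _ (lerD Lh Lk))// -LD//; apply: leL.
- by apply: bounded_mfun_indic_dist => //; exact: measurableU.
- exact: bounded_mfunD.
move=> x; have /andP[? ?] := h01 x; have /andP[? ?] := k01 x.
have := ler_norm (\1_A x - h x); have := ler_norm (- (\1_A x - h x)).
have := ler_norm (\1_B x - k x); have := ler_norm (- (\1_B x - k x)).
rewrite !normrN !indicE in_setU ler_norml.
by case: (x \in A); case: (x \in B); case: (leP (h x) (k x)) => /= ? ? ? ? ?;
  apply/andP; split; lra.
Qed.

(** Ramps of slope [m] starting at [a] agree with the indicator at each point from some [m] on: for
    every [m] up to [a], and beyond [a] once [m * (x - a) >= 1]. *)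
Lemma continuous_approx_ray (a : R) : continuous_approx L `]a, +oo[.
Proof.
move=> e e0.
pose h (m : nat) (x : R) := Num.min 1 (Num.max 0 (m%:R * (x - a))).
have ch m : continuous (h m).
  have c1 : continuous (fun x : R => m%:R * (x - a)).
    move=> x; apply: cvgM; first exact: cvg_cst.
    by apply: cvgB; [exact: cvg_id|exact: cvg_cst].
  have c2 : continuous (fun x : R => Num.max 0 (m%:R * (x - a))).
    by move=> x; have := continuous_max (@cst_continuous _ R 0 x) (c1 x); exact.
  by move=> x; have := continuous_min (@cst_continuous _ R 1 x) (c2 x); exact.
have h01 m x : 0 <= h m x <= 1.
  by rewrite /h le_min ge_min le_max !lexx ler01.
have mA : measurable (`]a, +oo[%classic : set R) by exact: measurable_itv.
have [m|m x|x|m Lm] := Lsmall (fun m x => `|\1_(`]a, +oo[) x - h m x|) _ e0.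
- by have [] := bounded_mfun_indic_dist _ _ mA (ch m) (h01 m).
- rewrite normr_ge0/= ler_norml.
  have /andP[? ?] := indic01 `]a, +oo[ x; have /andP[? ?] := h01 m x.
  by apply/andP; split; lra.
- have [xa|ax] := leP x a.
    exists 0%N => m _; rewrite indicE memNset/=; last first.
      by rewrite in_itv/= andbT; apply/negP; rewrite -leNgt.
    rewrite /h (max_idPl _) ?mulr_ge0_le0 ?subr_le0// (min_idPr _)//.
    by rewrite subrr normr0.
  exists (Num.truncn (x - a)^-1).+1 => m nm.
  rewrite indicE mem_set/=; last by rewrite in_itv/= andbT.
  have xa0 : 0 < x - a by rewrite subr_gt0.
  have : 1 <= m%:R * (x - a).
    rewrite -ler_pdivrMr// div1r (le_trans (ltW (truncnS_gt _)))//.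
    by rewrite ler_nat.
  rewrite /h => m1; rewrite (max_idPr _) ?(le_trans ler01)// (min_idPl _)//.
  by rewrite subrr normr0.
by exists (h m).
Qed.

Lemma continuous_approx0 : continuous_approx L set0.
Proof.
move=> e e0; exists (cst 0); split.
- exact: cst_continuous.
- by move=> x; rewrite lexx ler01.
have [//|m x|x|m] := Lsmall (fun _ _ => 0) e e0.
- by rewrite lexx ler01.
- by exists 0%N.
rewrite (_ : (fun x => `|_|) = fun=> 0)//.
by apply/funext => x; rewrite indicE in_set0 subr0 normr0.
Qed.

(** Finite unions are approximable by induction, and the remainder of the countable union vanishes
    at each point from some index on, so that [L] of it becomes small. *)
Lemma continuous_approx_bigcup (F : nat -> set R) :
  (forall k, measurable (F k) /\ continuous_approx L (F k)) ->
  continuous_approx L (\bigcup_k F k).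
Proof.
move=> HF.
pose U m := \big[setU/set0]_(k < m) F k.
have mU m : measurable (U m) by apply: bigsetU_measurable => k _; case: (HF k).
have aU m : continuous_approx L (U m).
  elim: m => [|m IH].
    by rewrite /U big_ord0; exact: continuous_approx0.
  rewrite /U big_ord_recr; apply: continuous_approxU => //.
  - exact: mU.
  - by have [] := HF m.
  - by have [] := HF m.
have mF : measurable (\bigcup_k F k) by apply: bigcupT_measurable => k; case: (HF k).
have UF m x : U m x -> (\bigcup_k F k) x.
  by rewrite /U -bigcup_mkord => -[k _ Fkx]; exists k.
move=> e e0; have e2 : 0 < e / 2 by rewrite divr_gt0.
have [m|m x|x|m Lm] := Lsmall (fun m x => \1_(\bigcup_k F k) x - \1_(U m) x) _ e2.
- apply: measurable_funB; first exact: measurable_indic.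
  by apply: measurable_indic; exact: mU.
- rewrite !indicE; case: (boolP (x \in U m)) => /=.
    by rewrite inE => /UF xF; rewrite mem_set//= subrr lexx ler01.
  by move=> _; case: (x \in \bigcup_k F k); rewrite /= subr0 ?lexx ?ler01.
- case: (boolP (x \in \bigcup_k F k)) => [|xF].
    rewrite inE => -[k _ Fkx]; exists k.+1 => m km.
    rewrite !indicE !mem_set ?subrr//; last by exists k.
    by rewrite /U -bigcup_mkord; exists k.
  exists 0%N => m _; rewrite !indicE (negbTE xF) memNset ?subrr//.
  by move=> /UF; rewrite -inE (negbTE xF).
have [h [ch h01 Lh]] := aU m _ e2; exists h; split => //.
have -> : e = e / 2 + e / 2 by lra.
rewrite (le_trans _ (lerD Lm Lh))//.
have bU := bounded_mfun_indic_dist _ _ (mU m) ch h01.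
have bd : bounded_mfun (fun x => \1_(\bigcup_k F k) x - \1_(U m) x).
  split.
    apply: measurable_funB; first exact: measurable_indic.
    by apply: measurable_indic; exact: mU.
  exists 1 => x; rewrite ler_norml.
  have /andP[? ?] := indic01 (\bigcup_k F k) x.
  have /andP[? ?] := indic01 (U m) x.
  by apply/andP; split; lra.
rewrite -LD//; apply: leL.
- exact: bounded_mfun_indic_dist.
- exact: bounded_mfunD.
- move=> x; rewrite -[leLHS](_ : `|(\1_(\bigcup_k F k) x - \1_(U m) x) +
    (\1_(U m) x - h x)| = _); last by congr `|_|; ring.
  rewrite (le_trans (ler_normD _ _))// lerD2r ger0_norm// !indicE.
  case: (boolP (x \in U m)) => /=.
    by rewrite inE => /UF xF; rewrite mem_set//= subrr.
  by move=> _; case: (x \in \bigcup_k F k); rewrite /= subr0 ?lexx ?ler01.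
Qed.

(** The measurable sets that can be approximated form a sigma-algebra containing the open rays,
    which generate the Borel sets. *)
Lemma measurable_continuous_approx A : measurable A -> continuous_approx L A.
Proof.
move=> mA; suff [] : (measurable A /\ continuous_approx L A) by [].
have : (@RGenOInfty.G R).-sigma.-measurable A.
  by rewrite -RGenOInfty.measurableE.
pose P := [set A : set R | measurable A /\ continuous_approx L A].
apply: (@smallest_sub _ (sigma_algebra setT) _ P).
- split.
  + by split => //; exact: continuous_approx0.
  + move=> B [mB aB]; rewrite setTD; split; first exact: measurableC.
    exact: continuous_approxC.
  + move=> F HF; split; first by apply: bigcupT_measurable => k; case: (HF k).
    exact: continuous_approx_bigcup.
- move=> _ [a ->]; split; first exact: measurable_itv.
  exact: continuous_approx_ray.
Qed.

End ContinuousApproximation.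

(** * Derivative rules for functions written pointwise *)

Section PointwiseDerivatives.
Variable R : realType.
Implicit Types (f g : R -> R) (x : R).

Lemma is_derive_mul f g x df dg : is_derive x 1 f df -> is_derive x 1 g dg ->
  is_derive x 1 (fun t => f t * g t) (df * g x + f x * dg).
Proof.
move=> Df Dg; apply: is_derive_eq.
by rewrite /GRing.scale/= addrC [g x * _]mulrC.
Qed.

Lemma is_derive_add f g x df dg : is_derive x 1 f df -> is_derive x 1 g dg ->
  is_derive x 1 (fun t => f t + g t) (df + dg).
Proof. by move=> Df Dg; exact: is_deriveD. Qed.

Lemma is_derive_bigsum n (h : 'I_n -> R -> R) (dh : 'I_n -> R) x :
  (forall i, is_derive x 1 (h i) (dh i)) ->
  is_derive x 1 (fun t => \sum_(i < n) h i t) (\sum_(i < n) dh i).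
Proof.
move=> dH; rewrite (_ : (fun t => _) = \sum_(i < n) h i); first exact: is_derive_sum.
by apply/funext => t; rewrite fct_sumE.
Qed.

Lemma is_derive_inv_pt f x df : f x != 0 -> is_derive x 1 f df ->
  is_derive x 1 (fun t => (f t)^-1) (- df * (f x)^-1 ^+ 2).
Proof.
move=> fx0 Df; have := is_deriveV fx0 Df; move=> D; apply: is_derive_eq.
by rewrite /GRing.scale/= exprVn mulNr [_ * df]mulrC mulNr.
Qed.

End PointwiseDerivatives.

(** * Moments of the sphere by integration over the unit ball *)

Section RadialIntegration.
Variable R : realType.
Notation mu := (@lebesgue_measure R).

Definition ind_le (b y : R) : R := if y <= b then 1 else 0.

Lemma measurable_ind_le b : measurable_fun setT (ind_le b).
Proof.
rewrite (_ : ind_le b = \1_(`]-oo, b])); first exact: measurable_indic.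
apply/funext => y; rewrite /ind_le indicE; case: ifPn => yb.
  by rewrite mem_set//= in_itv.
by rewrite memNset//= in_itv/=; exact/negP.
Qed.

Lemma measurable_inv_ge0 {d} {T : measurableType d} (u : T -> R) :
  measurable_fun setT u -> (forall t, 0 <= u t) ->
  measurable_fun setT (fun t => (u t)^-1).
Proof.
move=> mu_ u0; rewrite (_ : (fun t => _) = (@powR R)^~ (-1) \o u).
  by apply: measurableT_comp => //; exact: measurable_powR.
by apply/funext => t /=; rewrite powR_inv1.
Qed.

(** For lines through the origin, where [1 / |x|^2] is singular at a single point. *)
Lemma Rintegral_eq_except (f g : R -> R) (a b c : R) :
  measurable_fun setT f -> measurable_fun setT g ->
  (forall t, t != c -> f t = g t) ->
  \int[mu]_(t in `[a, b]) f t = \int[mu]_(t in `[a, b]) g t.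
Proof.
move=> mf mg fg; rewrite /Rintegral; congr fine.
apply: ae_eq_integral.
- exact: measurable_itv.
- by apply/measurable_EFinP; exact: measurable_funTS.
- by apply/measurable_EFinP; exact: measurable_funTS.
- exists [set c]; split; first exact: measurable_set1.
    exact: lebesgue_measure_set1.
  move=> t /= H; apply: contrapT => /eqP tc; apply: H => _.
  by rewrite fg.
Qed.

Lemma Rintegral_restrict_itv (f : R -> R) (s : R) : 0 <= s <= 1 ->
  \int[mu]_(t in `[-1, 1]) (ind_le (s ^+ 2) (t ^+ 2) * f t) =
  \int[mu]_(t in `[- s, s]) f t.
Proof.
move=> /andP[s0 s1]; rewrite Rintegral_mkcond [RHS]Rintegral_mkcond.
apply: eq_Rintegral => t _; rewrite !patchE.
have ts : (t ^+ 2 <= s ^+ 2) = (t \in `[- s, s]).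
  by rewrite in_itv/= -ler_norml -[in LHS]real_normK ?num_real// ler_pXn2r// nnegrE.
rewrite /ind_le ts; have [tS|tS] := boolP (t \in `[- s, s]).
  rewrite mem_set/=; last first.
    move: tS; rewrite !in_itv/= => /andP[st ts'].
    by rewrite (le_trans _ st) ?lerN2// (le_trans ts').
  by rewrite mem_set//= mul1r.
rewrite mul0r if_same memNset//; exact/negP.
Qed.

(** On the chord [t^2 + q <= 1] the integrand is the derivative of [P t * (1 - 1 / (t^2 + q)) / 2],
    which vanishes at both ends. For [q = 0] the chord meets the singularity, and the cubic shape of
    [P] removes it. *)
Lemma radial_by_parts (P dP : R -> R) (q c : R) : 0 <= q ->
  (forall t : R, is_derive t 1 P (dP t)) -> continuous dP ->
  (q = 0 -> forall t, P t = c * t ^+ 3 /\ dP t = c * (3 * t ^+ 2)) ->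
  \int[mu]_(t in `[-1, 1]) (ind_le 1 (t ^+ 2 + q) *
    (t * P t * (t ^+ 2 + q)^-1 ^+ 2 + (1 - (t ^+ 2 + q)^-1) / 2 * dP t)) = 0.
Proof.
move=> q0 dPP cdP Pq0.
(* For [q > 1] the line misses the ball; otherwise it meets the ball in [[-s, s]]. *)
have [q1|q1] := ltP 1 q.
  rewrite -[RHS](Rintegral_set0 mu (fun=> 0)) Rintegral_mkcond [RHS]Rintegral_mkcond.
  apply: eq_Rintegral => t _; rewrite !patchE in_set0; case: ifPn => // _.
  rewrite /ind_le ifN ?mul0r//.
  by rewrite -ltNge (lt_le_trans q1)// lerDr sqr_ge0.
set s := Num.sqrt (1 - q).
have sE : s ^+ 2 = 1 - q by rewrite sqr_sqrtr// subr_ge0.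
have s01 : 0 <= s <= 1.
  rewrite sqrtr_ge0/= -[leRHS]sqrtr1 ler_sqrt// lerBlDr lerDl//.
have tE t : ind_le 1 (t ^+ 2 + q) = ind_le (s ^+ 2) (t ^+ 2).
  by rewrite /ind_le sE lerBrDr.
under eq_Rintegral do rewrite tE.
rewrite Rintegral_restrict_itv//.
have ss : - s <= s by have /andP[? ?] := s01; lra.
have [qe|qn] := eqVneq q 0; last first.
  have u0 t : t ^+ 2 + q != 0.
    by rewrite gt_eqF// ltr_wpDl ?sqr_ge0// lt_neqAle eq_sym qn.
  pose F t := P t * ((1 - (t ^+ 2 + q)^-1) / 2).
  have du (t : R) : is_derive t 1 (fun t : R => t ^+ 2 + q) (2 * t).
    rewrite (_ : 2 * t = (1 * t + t * 1) + 0); last ring.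
    apply: (is_derive_add _ (fun t => t ^+ 2) (cst q)).
    exact: (is_derive_mul _ id id).
  have dF (t : R) : is_derive t 1 F
      (t * P t * (t ^+ 2 + q)^-1 ^+ 2 + (1 - (t ^+ 2 + q)^-1) / 2 * dP t).
    have dinv := is_derive_inv_pt _ (fun t => t ^+ 2 + q) t _ (u0 t) (du t).
    have d1 : is_derive t 1 (fun t : R => (1 - (t ^+ 2 + q)^-1) / 2)
        (t * (t ^+ 2 + q)^-1 ^+ 2).
      rewrite (_ : (fun t : R => _) = fun t : R => 2^-1 + (- 2^-1) * (t ^+ 2 + q)^-1); last first.
        by apply/funext => y; field; exact: u0.
      rewrite [X in is_derive _ _ _ X](_ : _ = 0 + (0 * (t ^+ 2 + q)^-1 +
        (- 2^-1) * (- (2 * t) * (t ^+ 2 + q)^-1 ^+ 2))); last by field; exact: u0.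
      apply: (is_derive_add _ (cst 2^-1)).
      exact: (is_derive_mul _ (cst (- 2^-1))).
    rewrite [X in is_derive _ _ _ X](_ : _ = dP t * ((1 - (t ^+ 2 + q)^-1) / 2)
      + P t * (t * (t ^+ 2 + q)^-1 ^+ 2)); last ring.
    exact: is_derive_mul.
  rewrite (Rintegral_FTC _ F)//.
    by rewrite /F sqrrN sE subrK invr1 subrr mul0r !mulr0 subrr.
  move=> t _.
  have cu : {for t, continuous (fun t : R => (t ^+ 2 + q)^-1)}.
    exact: is_derive_continuous (is_derive_inv_pt _ (fun t => t ^+ 2 + q) t _ (u0 t) (du t)).
  have cP : {for t, continuous P} by exact: is_derive_continuous (dPP t).
  apply: cvgD; last first.
    apply: cvgM; last exact: cdP.
    apply: cvgM; last exact: cvg_cst.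
    by apply: cvgB => //; exact: cvg_cst.
  apply: cvgM.
    by apply: cvgM => //; exact: cvg_id.
  by rewrite expr2; apply: cvgM.
(* Now [q = 0]: away from 0 the integrand is the polynomial [g], whose antiderivative [G] vanishes
   at -1 and at 1. *)
have s1 : s = 1 by rewrite /s qe subr0 sqrtr1.
rewrite s1 qe.
pose g t : R := c * ((3 / 2) * t ^+ 2 - 1 / 2).
pose G t : R := c / 2 * (t * (t * t) - t).
have dG (t : R) : is_derive t 1 G (g t).
  rewrite (_ : g t = 0 * (t * (t * t) - t) + c / 2 *
    ((1 * (t * t) + t * (1 * t + t * 1)) - 1)); last by rewrite /g; field.
  apply: (is_derive_mul _ (cst (c / 2))).
  apply: (is_derive_add _ (fun t => t * (t * t)) (fun t => - t)).
  apply: (is_derive_mul _ id (fun t => t * t)).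
  exact: (is_derive_mul _ id id).
have cg : continuous g.
  move=> t; apply: cvgM; first exact: cvg_cst.
  apply: cvgB; last exact: cvg_cst.
  apply: cvgM; first exact: cvg_cst.
  by rewrite expr2; apply: cvgM; exact: cvg_id.
transitivity (\int[mu]_(t in `[(-1)%R, 1]) g t); last first.
  have H11 : -1 <= 1 :> R by lra.
  rewrite (Rintegral_FTC _ G g _ _ H11 (fun t _ => dG t) (fun t _ => cg t)).
  by rewrite /G; field.
apply: (Rintegral_eq_except _ _ _ _ 0).
- have mP : measurable_fun setT P.
    apply: continuous_measurable_fun => t; exact: is_derive_continuous (dPP t).
  have mdP : measurable_fun setT dP by exact: continuous_measurable_fun.
  have mi : measurable_fun setT (fun t : R => (t ^+ 2 + 0)^-1).
    apply: measurable_inv_ge0 => [|t]; last by rewrite addr0 sqr_ge0.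
    by apply: measurable_funD => //; exact: exprn_measurable.
  apply: measurable_funD.
    apply: measurable_funM; first by apply: measurable_funM.
    exact: measurable_funX.
  apply: measurable_funM => //; apply: measurable_funM => //.
  by apply: measurable_funB.
- exact: continuous_measurable_fun.
- move=> t t0; have [-> ->] := Pq0 qe t; rewrite /g addr0; field.
  exact: t0.
Qed.

Variable k : nat.
Notation bmeas g := (bounded_meas R (-1) 1 k g).
Notation I := (rint R (-1) 1 k).

Definition sqnorm (x : nat -> R) : R := \sum_(i < k) x i ^+ 2.
Definition ball_ind (x : nat -> R) : R := ind_le 1 (sqnorm x).
(** Since [0^-1 = 0], this is 0 at the origin. For [x] uniform in the ball it is the product of two
    coordinates of a uniform point of the unit sphere. *)
Definition qform (i j : 'I_k) (x : nat -> R) : R := x i * x j * (sqnorm x)^-1.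

Lemma ball_indE x : ball_ind x = ind_le 1 (sqnorm x).
Proof. by []. Qed.

Lemma qformE i j x : qform i j x = x i * x j * (sqnorm x)^-1.
Proof. by []. Qed.

Let N11 : -1 <= 1 :> R. Proof. lra. Qed.

Lemma sqnorm_ge0 (x : nat -> R) : 0 <= sqnorm x.
Proof. by apply: sumr_ge0 => i _; exact: sqr_ge0. Qed.

Lemma sqr_le_sqnorm (x : nat -> R) (i : 'I_k) : x i ^+ 2 <= sqnorm x.
Proof.
rewrite /sqnorm (bigD1 i)//= lerDl; apply: sumr_ge0 => j _; exact: sqr_ge0.
Qed.

Lemma bmeas_sqnorm : bmeas sqnorm.
Proof. by apply: bmeas_sum => i _; apply: bmeasX; exact: bmeas_coord. Qed.

Lemma bmeas_ball_ind : bmeas ball_ind.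
Proof.
apply: (bmeas_comp _ _ _ _ _ _ 1 (measurable_ind_le 1)); last exact: bmeas_sqnorm.
by move=> y; rewrite /ind_le; case: ifP => _; rewrite ?normr1 ?normr0 ?ler01.
Qed.

Lemma bmeas_qform i j : bmeas (qform i j).
Proof.
have [mij _] : bmeas (fun x => x i * x j) by apply: bmeasM; exact: bmeas_coord.
split.
  apply: meas_coordM => //.
  move=> d T u mu_; apply: measurable_inv_ge0; last by move=> t; exact: sqnorm_ge0.
  by case: bmeas_sqnorm => + _; exact.
exists 1 => x _; rewrite /qform normrM normfV (ger0_norm (sqnorm_ge0 x)).
have [u0|u0] := eqVneq (sqnorm x) 0.
  by rewrite u0 invr0 mulr0 ler01.
rewrite ler_pdivrMr; last by rewrite lt_neqAle eq_sym u0 sqnorm_ge0.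
rewrite mul1r; have := sqr_le_sqnorm x i; have := sqr_le_sqnorm x j.
have : 0 <= (x i - x j) ^+ 2 by exact: sqr_ge0.
have : 0 <= (x i + x j) ^+ 2 by exact: sqr_ge0.
by rewrite !expr2 ler_norml => *; apply/andP; split; lra.
Qed.

Definition moment4 (i j l m : 'I_k) : R :=
  I (fun x => ball_ind x * (qform i j x * qform l m x)).

(** What integration by parts leaves of [moment4]; the minus sign makes all terms of that expansion
    positive multiples. *)
Definition phi_moment (l m : 'I_k) : R :=
  - I (fun x => ball_ind x * ((x l * x m - qform l m x) / 2)).

Definition kdelta (i j : 'I_k) : R := (i == j)%:R.

Lemma kdeltaE i j : kdelta i j = (i == j)%:R.
Proof. by []. Qed.

Definition q_coord (x : nat -> R) (i : 'I_k) : R := \sum_(j < k | j != i) x j ^+ 2.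

Lemma sqnorm_set_coord (x : nat -> R) (i : 'I_k) t :
  sqnorm (set_coord R x i t) = t ^+ 2 + q_coord x i.
Proof.
rewrite /sqnorm (bigD1 i)//= /set_coord eqxx; congr (_ + _).
by apply: eq_bigr => j ji; rewrite ifN.
Qed.

Lemma is_derive_set_coord (x : nat -> R) (i j : 'I_k) (t : R) :
  is_derive t 1 (fun t => set_coord R x i t j) (kdelta i j).
Proof.
rewrite /set_coord /kdelta; have [<-|ij] := eqVneq i j.
  by rewrite eqxx; exact: is_derive_id.
rewrite [_ == _](_ : _ = false); first exact: is_derive_cst.
by apply/negbTE; rewrite eq_sym; apply: contra ij => /eqP/val_inj->.
Qed.

Lemma continuous_set_coord (x : nat -> R) (i j : 'I_k) :
  continuous (fun t => set_coord R x i t j).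
Proof. by move=> t; exact: is_derive_continuous (is_derive_set_coord x i j t). Qed.

Lemma bmeas_phi (l m : 'I_k) : bmeas (fun x => ball_ind x * ((x l * x m - qform l m x) / 2)).
Proof.
apply: bmeasM; first exact: bmeas_ball_ind.
apply: bmeasM; last exact: bmeas_cst.
apply: bmeasB; last exact: bmeas_qform.
by apply: bmeasM; exact: bmeas_coord.
Qed.

Lemma bmeas_moment4 i j l m :
  bmeas (fun x => ball_ind x * (qform i j x * qform l m x)).
Proof.
by apply: bmeasM; [exact: bmeas_ball_ind|apply: bmeasM; exact: bmeas_qform].
Qed.

(* With [u = |x|^2], [x_i / u^2] is the [x_i]-derivative of [(1 - 1/u) / 2],
   which vanishes on the unit sphere. *)
Lemma moment4_by_parts i j l m : moment4 i j l m =
  kdelta i j * phi_moment l m + kdelta i l * phi_moment j m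
  + kdelta i m * phi_moment j l.
Proof.
pose J l m x := ball_ind x * ((x (nat_of_ord l) * x (nat_of_ord m) - qform l m x) / 2).
have nJ c l' m' : bmeas (fun x => c * J l' m' x) by apply: bmeasZ; exact: bmeas_phi.
apply/eqP; rewrite -subr_eq0; apply/eqP.
(* The difference of the two sides becomes a single integral; along coordinate [i] it is the one of
   [radial_by_parts]. *)
transitivity (I (fun x => ball_ind x * (qform i j x * qform l m x) +
  (kdelta i j * J l m x + kdelta i l * J j m x + kdelta i m * J j l x))).
  rewrite rintD//; [|exact: bmeas_moment4|by do 2 apply: bmeasD => //].
  rewrite rintD//; [|exact: bmeasD].
  rewrite rintD// !rintZ//; try exact: bmeas_phi.
  by rewrite /moment4 /phi_moment /J; ring.
apply: (rint_coord_eq0 _ _ _ N11 _ _ i) => //.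
  apply: bmeasD; first exact: bmeas_moment4.
  by do 2 apply: bmeasD => //.
move=> x xc; pose X t := set_coord R x i t.
pose P t := X t j * X t l * X t m.
pose dP t := kdelta i j * (X t l * X t m) + kdelta i l * (X t j * X t m)
  + kdelta i m * (X t j * X t l).
have dPP (t : R) : is_derive t 1 P (dP t).
  rewrite (_ : dP t = (kdelta i j * X t l + X t j * kdelta i l) * X t m +
    (X t j * X t l) * kdelta i m); last by rewrite /dP; ring.
  apply: (is_derive_mul _ (fun t => X t j * X t l) (fun t => X t m)).
    by apply: (is_derive_mul _ (fun t => X t j) (fun t => X t l));
      exact: is_derive_set_coord.
  exact: is_derive_set_coord.
have cX := continuous_set_coord x i.
have cdP : continuous dP.
  move=> t; apply: cvgD; [apply: cvgD|]; (apply: cvgM; first exact: cvg_cst);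
    by apply: cvgM; exact: cX.
have q0 : 0 <= q_coord x i by apply: sumr_ge0 => r _; exact: sqr_ge0.
rewrite -[RHS](radial_by_parts P dP (q_coord x i)
  (kdelta i j * kdelta i l * kdelta i m) q0 dPP cdP).
  apply: eq_Rintegral => t _; rewrite /J /ball_ind /qform !sqnorm_set_coord.
  rewrite /P /dP -/(X t) (_ : X t i = t); last by rewrite /X /set_coord eqxx.
  ring.
(* If all other coordinates vanish, then [X t r = kdelta i r * t], so [P] is the required multiple
   of [t^3]. *)
move=> qx0 t.
have X0 r : i != r -> X t r = 0.
  move=> ir; rewrite /X /set_coord ifN; last first.
    by rewrite eq_sym; apply: contra ir => /eqP/val_inj->.
  apply/eqP; rewrite -sqrf_eq0 eq_le sqr_ge0 andbT -qx0 /q_coord.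
  rewrite (bigD1 r)/=; last by rewrite eq_sym.
  by rewrite lerDl; apply: sumr_ge0 => s _; exact: sqr_ge0.
have XE (r : 'I_k) : X t r = kdelta i r * t.
  rewrite /kdelta; have [<-|ir] := eqVneq i r.
    by rewrite mul1r /X /set_coord eqxx.
  by rewrite mul0r X0.
rewrite /P /dP !XE; split; first ring.
by rewrite /kdelta; case: (i == j); case: (i == l); case: (i == m); rewrite /=; ring.
Qed.

Lemma moment4C i j l m : moment4 i j l m = moment4 l m i j.
Proof. by apply: eq_rint => // x _; ring. Qed.

(* The symmetry of [moment4] compared with its asymmetric expansion by parts
   forces [phi_moment] to be a multiple of the identity. *)
Lemma phi_moment_offdiag l m : l != m -> phi_moment l m = 0.
Proof.
move=> lm; have := moment4_by_parts l l l m; have := moment4_by_parts m l l l.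
rewrite (_ : moment4 l l l m = moment4 m l l l); last first.
  by apply: eq_rint => // x _; rewrite /qform; ring.
move=> ->; rewrite /kdelta eqxx (negbTE lm) eq_sym (negbTE lm) /= mulr1n mulr0n.
lra.
Qed.

Lemma phi_moment_diag l m : phi_moment l l = phi_moment m m.
Proof.
have [->//|lm] := eqVneq l m.
(* The same moment expands to [phi_moment m m] from one side and to [phi_moment l l] from the
   other. *)
have := moment4_by_parts l l m m; have := moment4_by_parts m m l l.
rewrite moment4C => ->; rewrite /kdelta !eqxx eq_sym (negbTE lm) /= mulr1n mulr0n; lra.
Qed.

Definition ball_vol : R := I ball_ind.

(** The squared coordinates of [x / |x|] sum to 1 except at [x = 0], where they are all 0: this is
    the indicator of the origin. *)
Definition origin_ind (x : nat -> R) : R := 1 - \sum_(i < k) qform i i x.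

Lemma origin_indE x : origin_ind x = if sqnorm x == 0 then 1 else 0.
Proof.
rewrite /origin_ind /qform -mulr_suml; case: eqVneq => [->|u0].
  by rewrite invr0 mulr0 subr0.
by under eq_bigr do rewrite -expr2; rewrite divff// subrr.
Qed.

Lemma bmeas_origin_ind : bmeas origin_ind.
Proof.
apply: bmeasB; first exact: bmeas_cst.
by apply: bmeas_sum => i _; exact: bmeas_qform.
Qed.

Lemma qform_origin i j x : qform i j x * origin_ind x = 0.
Proof.
rewrite origin_indE /qform; case: eqVneq => [->|_]; last by rewrite mulr0.
by rewrite invr0 mulr0 mul0r.
Qed.

(** Along each line parallel to the first axis the integrand vanishes except possibly at [t = 0]. *)
Lemma rint_origin_ind : (0 < k)%N -> I (fun x => ball_ind x * origin_ind x) = 0.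
Proof.
move=> k0; pose i0 := Ordinal k0.
have ng : bmeas (fun x => ball_ind x * origin_ind x).
  by apply: bmeasM; [exact: bmeas_ball_ind|exact: bmeas_origin_ind].
apply: (rint_coord_eq0 _ _ _ N11 _ _ i0) => // x _.
rewrite -[RHS](Rintegral_set0 mu (fun=> 0)) [RHS]Rintegral_mkcond.
transitivity (\int[mu]_(t in `[(-1)%R, 1]) (cst 0 : R -> R) t).
  apply: (Rintegral_eq_except _ _ _ _ 0) => //.
    case: ng => + _; move/(_ _ _ (fun i t => set_coord R x i0 t i)); apply.
    by move=> i; rewrite /set_coord; case: eqP => _ //; exact: measurable_cst.
  move=> t t0; rewrite origin_indE sqnorm_set_coord ifN ?mulr0//.
  rewrite gt_eqF// ltr_wpDr ?exprn_even_gt0//.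
  by apply: sumr_ge0 => r _; exact: sqr_ge0.
rewrite Rintegral_mkcond; apply: eq_Rintegral => t _.
by rewrite !patchE in_set0; case: ifP.
Qed.

Lemma sum_delta (i : 'I_k) (F : 'I_k -> R) : \sum_j kdelta i j * F j = F i.
Proof.
rewrite (bigD1 i)//= /kdelta eqxx mul1r big1 ?addr0// => j ji.
by rewrite eq_sym (negbTE ji) mul0r.
Qed.

(** With [phi_moment = C * kdelta] the expansion by parts has the stated shape. [C] is found by
    summing over [i = j] and [l = m]: the moments add up to [ball_vol], the deltas to
    [k^2 + 2 k]. *)
Lemma moment4E i j l m : moment4 i j l m = ball_vol / (k%:R * (k%:R + 2)) *
  (kdelta i j * kdelta l m + kdelta i l * kdelta j m + kdelta i m * kdelta j l).
Proof.
have k0 : (0 < k)%N by case: i; case: k.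
pose C := phi_moment i i.
have DE r s : phi_moment r s = C * kdelta r s.
  rewrite /kdelta; have [<-|rs] := eqVneq r s.
    by rewrite mulr1; exact: phi_moment_diag.
  by rewrite mulr0 phi_moment_offdiag.
have ME i' j' l' m' : moment4 i' j' l' m' =
    C * (kdelta i' j' * kdelta l' m' + kdelta i' l' * kdelta j' m' + kdelta i' m' * kdelta j' l').
  by rewrite moment4_by_parts !DE; ring.
have kC : ball_vol = C * (k%:R * (k%:R + 2)).
  transitivity (\sum_(r < k) \sum_(s < k) moment4 r r s s).
    transitivity (I (fun x => ball_ind x - ball_ind x * origin_ind x)).
      rewrite rintB//; [|exact: bmeas_ball_ind|].
        by rewrite rint_origin_ind// subr0.
      by apply: bmeasM; [exact: bmeas_ball_ind|exact: bmeas_origin_ind].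
    rewrite /moment4.
    rewrite [RHS](eq_bigr (fun r => I (fun x =>
        \sum_(s < k) ball_ind x * (qform r r x * qform s s x)))); last first.
      by move=> r _; rewrite rint_sum// => s _; exact: bmeas_moment4.
    rewrite -rint_sum//; last by move=> r _; apply: bmeas_sum => s _; exact: bmeas_moment4.
    apply: eq_rint => // x _.
    under eq_bigr do rewrite -mulr_sumr -mulr_sumr.
    rewrite -mulr_sumr -mulr_suml.
    have -> : \sum_(i1 < k) qform i1 i1 x = 1 - origin_ind x by rewrite /origin_ind; ring.
    by rewrite origin_indE; case: ifP => _; ring.
  under eq_bigr => r _.
    rewrite (eq_bigr (fun s => C + kdelta r s * (2 * C))); last first.
      move=> s _; rewrite ME /kdelta !eqxx.
      by case: (r == s); rewrite /=; ring.
    rewrite big_split/= sum_delta sumr_const card_ord.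
    over.
  by rewrite sumr_const card_ord -[C *+ k]mulr_natr -mulr_natr; ring.
rewrite ME kC mulfK// mulf_neq0 ?pnatr_eq0 -?lt0n//.
Qed.

(** Contraction of the fourth moments over [l = m], as the squares sum to 1 off the origin. *)
Lemma moment2E i j : I (fun x => ball_ind x * qform i j x) =
  ball_vol / k%:R * kdelta i j.
Proof.
have k0 : (0 < k)%N by case: i; case: k.
transitivity (\sum_(l < k) moment4 i j l l).
  rewrite /moment4 -rint_sum//; last by move=> l _; exact: bmeas_moment4.
  apply: eq_rint => // x _; rewrite -mulr_sumr -mulr_sumr.
  have -> : \sum_(l < k) qform l l x = 1 - origin_ind x by rewrite /origin_ind; ring.
  by rewrite mulrBr qform_origin mulr1 subr0.
set c := ball_vol / (k%:R * (k%:R + 2)).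
rewrite (eq_bigr (fun l => c * kdelta i j + kdelta i l * (2 * c * kdelta j l))); last first.
  by move=> l _; rewrite moment4E -/c /kdelta eqxx /=; ring.
rewrite big_split/= sum_delta sumr_const card_ord -mulr_natr.
rewrite [kdelta j i](_ : _ = kdelta i j); last by rewrite /kdelta eq_sym.
rewrite /c; field.
by rewrite -natrD !pnatr_eq0 addn2 -lt0n k0.
Qed.

End RadialIntegration.

(** * From continuous test functions to total variation *)

Section TotalVariation.
Variables (R : realType) (n : nat).
Notation mu := (@lebesgue_measure R).
Notation phi := (normal_pdf (0 : R) 1).
Notation I := (rint R 0 1 n).
Notation bmeas g := (bounded_meas R 0 1 n g).
Variable f : (nat -> R) -> R.
Hypothesis mf : meas_coord R f.

(** Adding the two laws makes one and the same [h] close to a given indicator for both of them. *)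
Definition law_plus_gauss (psi : R -> R) : R :=
  I (fun x => psi (f x)) + \int[mu]_y (psi y * phi y).

Lemma bmeas_bounded_mfun psi : bounded_mfun R psi -> bmeas (fun x => psi (f x)).
Proof.
by move=> [mpsi [M bM]]; split; [exact: meas_coord_comp|exists M => x _].
Qed.

Lemma integrable_bounded_mfun psi : bounded_mfun R psi ->
  mu.-integrable setT (EFin \o (fun y => psi y * phi y)).
Proof. by move=> [mpsi [M bM]]; exact: integrable_bounded_normal_pdf bM. Qed.

Lemma positive_functional_law : positive_functional R law_plus_gauss.
Proof.
split.
- move=> psi1 psi2 b1 b2 le12; apply: lerD.
    by apply: le_rint; rewrite ?ler01//; exact: bmeas_bounded_mfun.
  apply: le_Rintegral => //; try exact: integrable_bounded_mfun.
  by move=> y _; rewrite ler_wpM2r// normal_pdf_ge0.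
- move=> psi1 psi2 b1 b2; rewrite /law_plus_gauss rintD ?ler01//;
    try exact: bmeas_bounded_mfun.
  under eq_Rintegral do rewrite mulrDl.
  rewrite RintegralD//; try exact: integrable_bounded_mfun.
  ring.
- move=> psi mpsi b01 psi0; rewrite -[X in _ --> X]addr0; apply: cvgD.
    apply: (rint_cvg0 _ _ _ ler01 n (fun m x => psi m (f x)) 1).
    + by move=> m; apply: meas_coord_comp.
    + by move=> m x _; have /andP[? ?] := b01 m (f x); rewrite ger0_norm.
    + move=> x _; have [N NP] := psi0 (f x).
      by apply: cvg_near_cst; exists N.
  have [] := @dominated_convergence _ _ _ mu setT measurableT
    (fun m y => (psi m y * phi y)%:E) (cst 0%E) (fun y => (phi y)%:E).
  + move=> m; apply/measurable_EFinP; apply: measurable_funM.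
      exact: mpsi.
    exact: measurable_normal_pdf.
  + exact: measurable_cst.
  + apply: aeW => y _; have [N NP] := psi0 y.
    by apply: cvg_near_cst; exists N => // m /NP /= ->; rewrite mul0r.
  + exact: integrable_normal_pdf.
  + apply: aeW => y m _; rewrite lee_fin.
    have /andP[? ?] := b01 m y; rewrite ger0_norm ?mulr_ge0 ?normal_pdf_ge0//.
    by rewrite ler_piMl ?normal_pdf_ge0.
  move=> _ _; rewrite integral0.
  exact: fine_cvg.
Qed.

Lemma normal_probE (A : set R) : measurable A ->
  normal_prob 0 1 A = (\int[mu]_y (\1_A y * phi y))%:E.
Proof.
move=> mA; rewrite /normal_prob /Rintegral fineK; last first.
  apply: integrable_fin_num => //.
  apply: (integrable_bounded_normal_pdf _ _ 1); first exact: measurable_indic.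
  by move=> y; have /andP[? ?] := indic01 R A y; rewrite ger0_norm.
rewrite [LHS]integral_mkcond; apply: eq_integral => y _.
by rewrite patchE indicE; case: ifP => _; rewrite /= ?mul1r ?mul0r.
Qed.

(** Replacing the indicator of a Borel set by a continuous [h] costs at most [e] under the two laws
    together, for every [e > 0]. *)
Lemma dTV_normal_le (K : R) :
  (forall h : R -> R, continuous h -> (forall y, 0 <= h y <= 1) ->
    `|I (fun x => h (f x)) - \int[mu]_y (h y * phi y)| <= K) ->
  (dTV (fun A => torus_prob n [set x | f x \in A]) (normal_prob 0 1) <= K%:E)%E.
Proof.
move=> HK; apply: ge_ereal_sup => _ [A mA <-].
have bA : bounded_mfun R (\1_A).
  split; first exact: measurable_indic.
  by exists 1 => y; have /andP[? ?] := indic01 R A y; rewrite ger0_norm.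
have -> : torus_prob n [set x | f x \in A] = (I (fun x => \1_A (f x)))%:E.
  rewrite -cube_int_rint ?ler01//; last exact: bmeas_bounded_mfun.
  rewrite /torus_prob; congr cube_int; apply/funext => x.
  rewrite !indicE; case: (boolP (f x \in A)) => fA; first by rewrite mem_set.
  by rewrite memNset//=; exact/negP.
rewrite normal_probE// -EFinB lee_fin.
apply/ler_addgt0Pr => e e0.
have [h [ch h01 Lh]] := measurable_continuous_approx _ _ positive_functional_law _ mA _ e0.
have bd := bounded_mfun_indic_dist _ _ _ mA ch h01.
have bh : bounded_mfun R h.
  split; first exact: continuous_measurable_fun.
  by exists 1 => y; have /andP[? ?] := h01 y; rewrite ger0_norm.
have D1 : `|I (fun x => \1_A (f x)) - I (fun x => h (f x))| <=
    I (fun x => `|\1_A (f x) - h (f x)|).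
  have nA := bmeas_bounded_mfun _ bA; have nh := bmeas_bounded_mfun _ bh.
  have nd := bmeas_bounded_mfun _ bd.
  rewrite -rintB ?ler01// ler_norml; apply/andP; split.
    rewrite lerNl -mulN1r -rintZ ?ler01//; last exact: bmeasB.
    apply: le_rint; rewrite ?ler01//; first by apply: bmeasZ; exact: bmeasB.
    by move=> x _; rewrite mulN1r -normrN ler_norm.
  apply: le_rint; rewrite ?ler01//; first exact: bmeasB.
  by move=> x _; exact: ler_norm.
have D2 : `|\int[mu]_y (\1_A y * phi y) - \int[mu]_y (h y * phi y)| <=
    \int[mu]_y (`|\1_A y - h y| * phi y).
  have iA := integrable_bounded_mfun _ bA; have ih := integrable_bounded_mfun _ bh.
  rewrite -RintegralB//.
  rewrite (le_trans (le_normr_Rintegral _ _))//; last first.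
    rewrite le_eqVlt; apply/orP; left; apply/eqP/eq_Rintegral => y _.
    by rewrite -mulrBl normrM (ger0_norm (normal_pdf_ge0 _ _ _)).
  have := integrableB measurableT iA ih; exact.
have := HK h ch h01; move: Lh D1 D2; rewrite /law_plus_gauss.
move: (I _) (I _) (I _) (\int[mu]_y _) (\int[mu]_y _) (\int[mu]_y _).
move=> p q r s t u; rewrite !ler_norml => ? /andP[? ?] /andP[? ?] /andP[? ?].
by apply/andP; split; lra.
Qed.

End TotalVariation.

(** * Characters of the torus and their orthogonality *)

Section TorusCharacters.
Variables (R : realType) (n : nat).
Notation mu := (@lebesgue_measure R).
Notation I := (rint R 0 1 n).
Notation bmeas g := (bounded_meas R 0 1 n g).

Definition phase (m : 'rV[R]_n) (x : nat -> R) : R :=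
  2 * pi * \sum_(i < n) m 0 i * x i.

Definition int_vec (m : 'rV[R]_n) : Prop :=
  forall i, exists z : int, m 0 i = z%:~R.

Lemma phaseD m m' x : phase (m + m') x = phase m x + phase m' x.
Proof.
rewrite /phase -mulrDr -big_split/=; congr (_ * _).
by apply: eq_bigr => i _; rewrite mxE mulrDl.
Qed.

Lemma phaseB m m' x : phase (m - m') x = phase m x - phase m' x.
Proof.
rewrite /phase -mulrBr -sumrB; congr (_ * _).
by apply: eq_bigr => i _; rewrite !mxE mulrBl.
Qed.

Lemma int_vecD m m' : int_vec m -> int_vec m' -> int_vec (m + m').
Proof.
move=> mZ m'Z i; have [z zE] := mZ i; have [z' z'E] := m'Z i.
by exists (z + z'); rewrite mxE zE z'E intrD.
Qed.

Lemma int_vecB m m' : int_vec m -> int_vec m' -> int_vec (m - m').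
Proof.
move=> mZ m'Z i; have [z zE] := mZ i; have [z' z'E] := m'Z i.
by exists (z - z'); rewrite !mxE zE z'E intrB.
Qed.

Lemma sin_cos_int_shift (y : R) (z : int) :
  sin (y + 2 * pi * z%:~R) = sin y /\ cos (y + 2 * pi * z%:~R) = cos y.
Proof.
have nat_case (w : R) (p : nat) :
    sin (w + 2 * pi * p%:R) = sin w /\ cos (w + 2 * pi * p%:R) = cos w.
  have -> : 2 * pi * p%:R = (pi : R) *+ 2 *+ p by rewrite !mulr_natr mulr_natl.
  by split; [exact: (periodicn (@sinD2pi R))|exact: (periodicn (@cosD2pi R))].
case: z => p; first exact: nat_case.
have [s c] := nat_case (y + 2 * pi * (Negz p)%:~R) p.+1.
by rewrite -s -c NegzE mulrNz mulrN subrK.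
Qed.

Lemma bmeas_phase m : bmeas (phase m).
Proof.
apply: bmeasZ; apply: bmeas_sum => i _; apply: bmeasZ; exact: bmeas_coord.
Qed.

Lemma bmeas_sin_phase m : bmeas (fun x => sin (phase m x)).
Proof.
apply: (bmeas_comp _ _ _ _ (@sin R) _ 1); last exact: bmeas_phase.
  by apply: continuous_measurable_fun; exact: continuous_sin.
exact: sin_max.
Qed.

Lemma bmeas_cos_phase m : bmeas (fun x => cos (phase m x)).
Proof.
apply: (bmeas_comp _ _ _ _ (@cos R) _ 1); last exact: bmeas_phase.
  by apply: continuous_measurable_fun; exact: continuous_cos.
exact: cos_max.
Qed.

Lemma phase_set_coord m x (r : 'I_n) t : phase m (set_coord R x r t) =
  phase m (set_coord R x r 0) + 2 * pi * (m 0 r * t).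
Proof.
rewrite /phase -mulrDr; congr (_ * _).
rewrite (bigD1 r)//= [in RHS](bigD1 r)//= /set_coord eqxx mulr0 add0r addrC.
by congr (_ + _); apply: eq_bigr => i ir; rewrite !ifN.
Qed.

Lemma is_derive_phase m x (r : 'I_n) (t : R) :
  is_derive t 1 (fun t => phase m (set_coord R x r t)) (2 * pi * m 0 r).
Proof.
rewrite (_ : (fun t => _) = fun t =>
    phase m (set_coord R x r 0) + 2 * pi * m 0 r * t); last first.
  by apply/funext => s; rewrite phase_set_coord mulrA.
rewrite [X in is_derive _ _ _ X](_ : _ = 0 + (0 * t + 2 * pi * m 0 r * 1)); last ring.
apply: (is_derive_add _ (cst _)).
exact: (is_derive_mul _ (cst _) id).
Qed.

Lemma is_derive_sin_phase m x (r : 'I_n) (t : R) :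
  is_derive t 1 (fun t => sin (phase m (set_coord R x r t)))
    (2 * pi * m 0 r * cos (phase m (set_coord R x r t))).
Proof.
rewrite mulrC.
exact: (@is_derive1_comp R (@sin R) (fun t => phase m (set_coord R x r t)) t _ _
  (is_derive_sin _) (is_derive_phase m x r t)).
Qed.

Lemma is_derive_cos_phase m x (r : 'I_n) (t : R) :
  is_derive t 1 (fun t => cos (phase m (set_coord R x r t)))
    (- (2 * pi * m 0 r) * sin (phase m (set_coord R x r t))).
Proof.
rewrite mulNr -mulrN mulrC.
exact: (@is_derive1_comp R (@cos R) (fun t => phase m (set_coord R x r t)) t _ _
  (is_derive_cos _) (is_derive_phase m x r t)).
Qed.

Lemma phase_period m x (r : 'I_n) : int_vec m ->
  sin (phase m (set_coord R x r 1)) = sin (phase m (set_coord R x r 0)) /\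
  cos (phase m (set_coord R x r 1)) = cos (phase m (set_coord R x r 0)).
Proof.
move=> /(_ r)[z zE]; rewrite phase_set_coord zE mulr1.
exact: sin_cos_int_shift.
Qed.

(** If the component of [m] at [r] is nonzero, an antiderivative along coordinate [r] is a multiple
    of [sin (phase m)], with equal values at 0 and 1 by integrality. *)
Lemma rint_cos_phase m : int_vec m ->
  I (fun x => cos (phase m x)) = if m == 0 then 1 else 0.
Proof.
move=> mZ; case: eqVneq => [->|m0].
  transitivity (I (fun=> 1)).
    apply: eq_rint => // x _; rewrite /phase big1 ?mulr0 ?cos0// => i _.
    by rewrite mxE mul0r.
  by rewrite rint_cst ?ler01// subr0 expr1n mulr1.
have [r mr] : exists r, m 0 r != 0.
  apply/existsP; apply: contraNT m0 => /existsPn H; apply/eqP/rowP => i.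
  by rewrite mxE; apply/eqP; have := H i; rewrite negbK.
apply: (rint_coord_eq0 _ _ _ ler01 _ _ r) => //; first exact: bmeas_cos_phase.
move=> x _.
have pm0 : 2 * pi * m 0 r != 0 by rewrite !mulf_neq0// gt_eqF// pi_gt0.
pose F t := (2 * pi * m 0 r)^-1 * sin (phase m (set_coord R x r t)).
have dF (t : R) : is_derive t 1 F (cos (phase m (set_coord R x r t))).
  rewrite [X in is_derive _ _ _ X](_ : _ = 0 * sin (phase m (set_coord R x r t)) +
    (2 * pi * m 0 r)^-1 * (2 * pi * m 0 r * cos (phase m (set_coord R x r t)))).
    apply: (is_derive_mul _ (cst _)); exact: is_derive_sin_phase.
  by rewrite mul0r add0r mulKf.
rewrite (Rintegral_FTC _ F _ _ _ ler01 (fun t _ => dF t)); last first.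
  by move=> t _; exact: is_derive_continuous (is_derive_cos_phase m x r t).
by rewrite /F (phase_period _ _ _ mZ).1 subrr.
Qed.

(** Product-to-sum formula. The second term is the reason for excluding opposite frequencies. *)
Lemma rint_cos_mul_cos m m' : int_vec m -> int_vec m' ->
  I (fun x => cos (phase m x) * cos (phase m' x)) =
  2^-1 * ((if m == m' then 1 else 0) + (if m + m' == 0 then 1 else 0)).
Proof.
move=> mZ m'Z; rewrite -subr_eq0 -(rint_cos_phase _ (int_vecB _ _ mZ m'Z)).
rewrite -(rint_cos_phase _ (int_vecD _ _ mZ m'Z)).
rewrite -rintD ?ler01//; try exact: bmeas_cos_phase.
rewrite -rintZ ?ler01//; last by apply: bmeasD; exact: bmeas_cos_phase.
by apply: eq_rint => // x _; rewrite phaseB phaseD cosB cosD; field.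
Qed.

(** * Trigonometric sums and integration by parts on the torus *)

Section TrigonometricSums.
Variables (k : nat) (m w : 'I_k -> 'rV[R]_n).
Hypothesis mZ : forall j, int_vec (m j).

Definition sin_sum (al : 'I_k -> R) x : R := \sum_j al j * sin (phase (m j) x).
Definition cos_sum (al : 'I_k -> R) x : R := \sum_j al j * cos (phase (m j) x).

Lemma cos_sumE al x : cos_sum al x = \sum_j al j * cos (phase (m j) x).
Proof. by []. Qed.

Lemma bmeas_sin_sum al : bmeas (sin_sum al).
Proof. by apply: bmeas_sum => j _; apply: bmeasZ; exact: bmeas_sin_phase. Qed.

Lemma bmeas_cos_sum al : bmeas (cos_sum al).
Proof. by apply: bmeas_sum => j _; apply: bmeasZ; exact: bmeas_cos_phase. Qed.

Lemma is_derive_sin_sum al x (r : 'I_n) (t : R) :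
  is_derive t 1 (fun t => sin_sum al (set_coord R x r t))
    (cos_sum (fun j => al j * (2 * pi * m j 0 r)) (set_coord R x r t)).
Proof.
apply: is_derive_bigsum => j.
rewrite [X in is_derive _ _ _ X](_ : _ = 0 * sin (phase (m j) (set_coord R x r t))
  + al j * (2 * pi * m j 0 r * cos (phase (m j) (set_coord R x r t)))); last ring.
by apply: (is_derive_mul _ (cst _)); exact: is_derive_sin_phase.
Qed.

Lemma is_derive_cos_sum al x (r : 'I_n) (t : R) :
  is_derive t 1 (fun t => cos_sum al (set_coord R x r t))
    (sin_sum (fun j => - al j * (2 * pi * m j 0 r)) (set_coord R x r t)).
Proof.
apply: is_derive_bigsum => j.
rewrite [X in is_derive _ _ _ X](_ : _ = 0 * cos (phase (m j) (set_coord R x r t))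
  + al j * (- (2 * pi * m j 0 r) * sin (phase (m j) (set_coord R x r t)))); last ring.
by apply: (is_derive_mul _ (cst _)); exact: is_derive_cos_phase.
Qed.

(** With [m = w *m B] this is the inner product of [w i] and [w j] for the metric [B]. The matrix
    enters only through the pair [m], [w], where [w] stands for the inverse of [B] applied to
    [m]. *)
Definition gram (i j : 'I_k) : R := \sum_r m i 0 r * w j 0 r.

Section ByParts.
Variables (a : 'I_k -> R) (g g' : R -> R) (M : R).
Hypothesis dg : forall y : R, is_derive y 1 g (g' y).
Hypothesis cg' : continuous g'.
Hypothesis gM : forall y, `|g y| <= M.
Hypothesis g'M : forall y, `|g' y| <= M.

Let f := cos_sum a.

Let bmeas_g : bmeas (fun x => g (f x)).
Proof.
apply: (bmeas_comp _ _ _ _ g _ M) => //; last exact: bmeas_cos_sum.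
apply: continuous_measurable_fun => y; exact: is_derive_continuous (dg y).
Qed.

Let bmeas_g' : bmeas (fun x => g' (f x)).
Proof.
apply: (bmeas_comp _ _ _ _ g' _ M) => //; last exact: bmeas_cos_sum.
exact: continuous_measurable_fun.
Qed.

(* The divergence of [g(f) Y], where [Y r = sin_sum (a_j w_j,r)], integrates
   to 0 because all the functions involved are 1-periodic in each coordinate. *)
Lemma rint_divergence (r : 'I_n) :
  I (fun x => g' (f x) * sin_sum (fun j => - a j * (2 * pi * m j 0 r)) x *
                sin_sum (fun j => a j * w j 0 r) x +
              g (f x) * cos_sum (fun j => a j * w j 0 r * (2 * pi * m j 0 r)) x) = 0.
Proof.
apply: (rint_coord_eq0 _ _ _ ler01 _ _ r) => //.
  apply: bmeasD; apply: bmeasM => //; try exact: bmeas_cos_sum; try exact: bmeas_sin_sum.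
  by apply: bmeasM => //; exact: bmeas_sin_sum.
move=> x _; pose X t := set_coord R x r t.
pose F t := g (f (X t)) * sin_sum (fun j => a j * w j 0 r) (X t).
have df (t : R) : is_derive t 1 (fun t => f (X t)) _ := is_derive_cos_sum a x r t.
have dY (t : R) := is_derive_sin_sum (fun j => a j * w j 0 r) x r t.
have dgf (t : R) := @is_derive1_comp R g (fun t => f (X t)) t _ _ (dg _) (df t).
have dF (t : R) : is_derive t 1 F (g' (f (X t)) *
    sin_sum (fun j => - a j * (2 * pi * m j 0 r)) (X t) *
    sin_sum (fun j => a j * w j 0 r) (X t) +
    g (f (X t)) * cos_sum (fun j => a j * w j 0 r * (2 * pi * m j 0 r)) (X t)).
  exact: (is_derive_mul _ (fun t => g (f (X t)))
    (fun t => sin_sum (fun j => a j * w j 0 r) (X t)) t _ _ (dgf t) (dY t)).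
rewrite (Rintegral_FTC _ F _ _ _ ler01 (fun t _ => dF t)); last first.
  move=> t _.
  have cf : {for t, continuous (fun t => f (X t))} by exact: is_derive_continuous (df t).
  have cgf : {for t, continuous (fun t => g (f (X t)))}.
    exact: is_derive_continuous (dgf t).
  have cg'f : {for t, continuous (fun t => g' (f (X t)))}.
    by apply: (@continuous_comp _ _ _ (fun t => f (X t)) g') => //; exact: cg'.
  have cS al : {for t, continuous (fun t => sin_sum al (X t))}.
    exact: is_derive_continuous (is_derive_sin_sum al x r t).
  have cC al : {for t, continuous (fun t => cos_sum al (X t))}.
    exact: is_derive_continuous (is_derive_cos_sum al x r t).
  apply: cvgD; apply: cvgM => //; [|exact: cS|exact: cC].
  by apply: cvgM => //; exact: cS.
rewrite /F /f /cos_sum /sin_sum.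
rewrite [X in g X * _ - _](_ : _ = \sum_j a j * cos (phase (m j) (X 0))); last first.
  by apply: eq_bigr => j _; rewrite (phase_period _ _ _ (mZ j)).2.
rewrite [X in _ * X - _](_ : _ = \sum_j a j * w j 0 r * sin (phase (m j) (X 0))).
  by rewrite subrr.
by apply: eq_bigr => j _; rewrite (phase_period _ _ _ (mZ j)).1.
Qed.

(** Up to the factor [(2 * pi) ^+ 2] the squared length of the gradient of [f]: the differential has
    the components of [m], the gradient for the metric [B] those of [w], and their pairing is
    [gram]. *)
Definition grad_form x : R := \sum_i \sum_j
  a i * a j * gram i j * (sin (phase (m i) x) * sin (phase (m j) x)).

Lemma grad_formE x : grad_form x = \sum_i \sum_j
  a i * a j * gram i j * (sin (phase (m i) x) * sin (phase (m j) x)).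
Proof. by []. Qed.

Lemma bmeas_grad_form : bmeas grad_form.
Proof.
apply: bmeas_sum => i _; apply: bmeas_sum => j _; apply: bmeasZ.
by apply: bmeasM; exact: bmeas_sin_phase.
Qed.

Lemma torus_by_parts : I (fun x => g' (f x) * grad_form x) =
  I (fun x => g (f x) * cos_sum (fun j => a j * gram j j) x).
Proof.
have n1 : bmeas (fun x => g' (f x) * grad_form x).
  by apply: bmeasM => //; exact: bmeas_grad_form.
have n2 : bmeas (fun x => g (f x) * cos_sum (fun j => a j * gram j j) x).
  by apply: bmeasM => //; exact: bmeas_cos_sum.
(* Summing [rint_divergence] over [r] produces this difference with a common factor [2 * pi]. *)
suff : 2 * pi * (I (fun x => g (f x) * cos_sum (fun j => a j * gram j j) x) -
    I (fun x => g' (f x) * grad_form x)) = 0.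
  move/eqP; rewrite !mulf_eq0 pnatr_eq0/= (gt_eqF (pi_gt0 R))/= subr_eq0.
  by move/eqP.
rewrite -rintB ?ler01// -rintZ ?ler01//; last exact: bmeasB.
have H0 : I (fun x => \sum_(r < n) (
    g' (f x) * sin_sum (fun j => - a j * (2 * pi * m j 0 r)) x *
      sin_sum (fun j => a j * w j 0 r) x +
    g (f x) * cos_sum (fun j => a j * w j 0 r * (2 * pi * m j 0 r)) x)) = 0.
  rewrite rint_sum ?ler01//; first by apply: big1 => r _; exact: rint_divergence.
  move=> r _; apply: bmeasD; apply: bmeasM => //;
    try exact: bmeas_cos_sum; try exact: bmeas_sin_sum.
  by apply: bmeasM => //; exact: bmeas_sin_sum.
rewrite -[RHS]H0; apply: eq_rint => // x _.
rewrite big_split/= addrC mulrBr; congr (_ + _).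
  rewrite -mulr_sumr mulrCA; congr (_ * _); rewrite /cos_sum exchange_big/= mulr_sumr.
  apply: eq_bigr => j _; rewrite /gram mulr_sumr !mulr_suml mulr_sumr.
  by apply: eq_bigr => r _; ring.
under [RHS]eq_bigr do rewrite -mulrA.
rewrite -mulr_sumr mulrCA -mulrN; congr (_ * _); rewrite /grad_form.
under [RHS]eq_bigr => r _.
  rewrite /sin_sum mulr_suml; under eq_bigr do rewrite mulr_sumr; over.
rewrite [RHS]exchange_big/= mulr_sumr -sumrN; apply: eq_bigr => i _.
rewrite [RHS]exchange_big/= mulr_sumr -sumrN; apply: eq_bigr => j _.
rewrite /gram mulr_sumr mulr_suml mulr_sumr -sumrN.
by apply: eq_bigr => r _; ring.
Qed.

End ByParts.
End TrigonometricSums.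
End TorusCharacters.

(** * Absolute values under cube integrals *)

Section RintNorm.
Variables (R : realType) (a b : R) (k : nat).
Hypothesis ab : a <= b.

Lemma bounded_meas_norm g : bounded_meas R a b k g ->
  bounded_meas R a b k (fun x => `|g x|).
Proof.
move=> [mg [M gM]]; split; first exact: meas_coord_comp.
by exists M => x xc; rewrite normr_id gM.
Qed.

Lemma normr_rint_le_fun g h : bounded_meas R a b k g -> bounded_meas R a b k h ->
  (forall x, incube R a b k x -> `|g x| <= h x) -> `|rint R a b k g| <= rint R a b k h.
Proof.
move=> gn hn gh; rewrite ler_norml; apply/andP; split.
  rewrite lerNl -mulN1r -rintZ//; apply: le_rint => //; first exact: bmeasZ.
  by move=> x xc; rewrite mulN1r (le_trans _ (gh x xc))// -normrN ler_norm.
apply: le_rint => // x xc; exact: le_trans (ler_norm _) (gh x xc).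
Qed.

End RintNorm.

(** * Stein's method for a fixed trigonometric sum *)

Section TorusStein.
Variables (R : realType) (n k : nat) (m w : 'I_k -> 'rV[R]_n).
Notation mu := (@lebesgue_measure R).
Notation phi := (normal_pdf (0 : R) 1).
Notation I := (rint R 0 1 n).
Notation bmeas g := (bounded_meas R 0 1 n g).
Hypothesis mZ : forall j, int_vec R n (m j).
Notation cos_sum := (cos_sum R n k m).
Notation gram := (gram R n k m w).
Notation grad_form := (grad_form R n k m w).
Notation kdelta := (kdelta R k).

Definition eig (j : 'I_k) : R := (2 * pi) ^+ 2 * gram j j.
Definition sqgrad (a : 'I_k -> R) x : R := (2 * pi) ^+ 2 * grad_form a x.

Lemma bmeas_sqgrad a : bmeas (sqgrad a).
Proof. by apply: bmeasZ; exact: bmeas_grad_form. Qed.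

Lemma bmeas_sqgrad_dist a c : bmeas (fun x => `|sqgrad a x - c|).
Proof.
apply: bounded_meas_norm; apply: bmeasB; first exact: bmeas_sqgrad.
exact: bmeas_cst.
Qed.

Lemma stein_torus_bound (a : 'I_k -> R) (tau : R) (h : R -> R) : 0 < tau ->
  continuous h -> (forall y, 0 <= h y <= 1) ->
  `|I (fun x => h (cos_sum a x)) - \int[mu]_y (h y * phi y)| <=
  tau^-1 * (2 * I (fun x => `|sqgrad a x - tau|) +
            2 * I (fun x => `|cos_sum (fun j => a j * (eig j - tau)) x|)).
Proof.
move=> tau0 ch h01; set c := \int[mu]_y _.
have [g [dg gb g'b]] := stein_solution R h ch h01; rewrite -/c in dg g'b.
pose g' y := y * g y + (h y - c).
have cg : continuous g by move=> y; exact: is_derive_continuous (dg y).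
have cg' : continuous g'.
  move=> y; apply: cvgD; first by apply: cvgM; [exact: cvg_id|exact: cg].
  by apply: cvgB; [exact: ch|exact: cvg_cst].
(* [e] is [- Laplacian f - tau * f]. *)
pose f := cos_sum a; pose e := cos_sum (fun j => a j * (eig j - tau)).
have nf : bmeas f by exact: bmeas_cos_sum.
have ne : bmeas e by exact: bmeas_cos_sum.
have ng : bmeas (fun x => g (f x)).
  by apply: (bmeas_comp _ _ _ _ g _ 2) => //; exact: continuous_measurable_fun.
have ng' : bmeas (fun x => g' (f x)).
  by apply: (bmeas_comp _ _ _ _ g' _ 2) => //; exact: continuous_measurable_fun.
have nh : bmeas (fun x => h (f x)).
  apply: (bmeas_comp _ _ _ _ h _ 1) => //; first exact: continuous_measurable_fun.
  by move=> y; have /andP[? ?] := h01 y; rewrite ger0_norm.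
have ns := bmeas_sqgrad a.
have BP : I (fun x => g' (f x) * sqgrad a x) =
    I (fun x => g (f x) * cos_sum (fun j => a j * eig j) x).
  transitivity ((2 * pi) ^+ 2 * I (fun x => g' (f x) * grad_form a x)).
    rewrite -rintZ ?ler01//; last by apply: bmeasM => //; exact: bmeas_grad_form.
    by apply: eq_rint => // x _; rewrite /sqgrad mulrCA.
  rewrite (torus_by_parts R n k m w mZ a g g' 2)// -rintZ ?ler01//; last first.
    by apply: bmeasM => //; exact: bmeas_cos_sum.
  apply: eq_rint => // x _; rewrite mulrCA; congr (_ * _).
  rewrite !cos_sumE mulr_sumr; apply: eq_bigr => j _; rewrite /eig; ring.
have nl : bmeas (fun x => g (f x) * cos_sum (fun j => a j * eig j) x).
  by apply: bmeasM => //; exact: bmeas_cos_sum.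
have nt : bmeas (fun x => g' (f x) * (tau - sqgrad a x)).
  by apply: bmeasM => //; apply: bmeasB => //; exact: bmeas_cst.
have nge : bmeas (fun x => g (f x) * e x) by exact: bmeasM.
(* Stein's equation at [f x] reads [h - c = g' - f * g]. Multiplied by [tau] and combined with [BP],
   it leaves only the two error terms. *)
have E : tau * (I (fun x => h (f x)) - c) =
    I (fun x => g' (f x) * (tau - sqgrad a x) + g (f x) * e x).
  have -> : c = I (fun=> c) by rewrite rint_cst ?ler01// subr0 expr1n mulr1.
  rewrite -rintB ?ler01//; last exact: bmeas_cst.
  rewrite -rintZ ?ler01//; last by apply: bmeasB => //; exact: bmeas_cst.
  apply/eqP; rewrite -subr_eq0 -rintB ?ler01//; last 2 first.
  - by apply: bmeasZ; apply: bmeasB => //; exact: bmeas_cst.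
  - exact: bmeasD.
  apply/eqP; transitivity (I (fun x => g' (f x) * sqgrad a x -
    g (f x) * cos_sum (fun j => a j * eig j) x)); last first.
    by rewrite rintB ?ler01// ?BP ?subrr//; exact: bmeasM.
  apply: eq_rint => // x _.
  have -> : e x = cos_sum (fun j => a j * eig j) x - tau * f x.
    rewrite /e /f !cos_sumE mulr_sumr -sumrB; apply: eq_bigr => j _; ring.
  by rewrite /g'; ring.
rewrite ler_pdivlMl// [leLHS](_ : _ = `|tau * (I (fun x => h (f x)) - c)|); last first.
  by rewrite normrM (ger0_norm (ltW tau0)).
rewrite E.
have nd := bmeas_sqgrad_dist a tau.
have nae := bounded_meas_norm _ _ _ _ _ ne; rewrite /e in nae.
have nZd := bmeasZ _ _ _ _ 2 _ nd; have nZe := bmeasZ _ _ _ _ 2 _ nae.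
rewrite -!rintZ ?ler01// -rintD ?ler01//.
apply: normr_rint_le_fun; rewrite ?ler01//.
- exact: bmeasD.
- exact: bmeasD.
move=> x _; rewrite (le_trans (ler_normD _ _))// !normrM; apply: lerD.
  by rewrite distrC ler_wpM2r//; exact: g'b.
by rewrite ler_wpM2r.
Qed.

(** * Variances over the torus *)

Section SecondMoments.
Hypothesis m_inj : forall i j, (m i == m j) = (i == j).
Hypothesis m_sum : forall i j, m i + m j != 0.

Lemma rint_cos_cos i j :
  I (fun x => cos (phase R n (m i) x) * cos (phase R n (m j) x)) = kdelta i j / 2.
Proof.
rewrite rint_cos_mul_cos// m_inj (negbTE (m_sum i j)) addr0 mulrC !kdeltaE.
by case: (i == j).
Qed.

Lemma rint_cos_sum_sqr al :
  I (fun x => cos_sum al x ^+ 2) = (\sum_j al j ^+ 2) / 2.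
Proof.
transitivity (\sum_i \sum_j al i * al j * (kdelta i j / 2)).
  transitivity (I (fun x => \sum_i \sum_j al i * al j *
    (cos (phase R n (m i) x) * cos (phase R n (m j) x)))).
    apply: eq_rint => // x _; rewrite expr2 !cos_sumE mulr_suml.
    apply: eq_bigr => i _; rewrite mulr_sumr; apply: eq_bigr => j _; ring.
  have nn i j : bmeas (fun x => al i * al j *
      (cos (phase R n (m i) x) * cos (phase R n (m j) x))).
    by apply: bmeasZ; apply: bmeasM; exact: bmeas_cos_phase.
  rewrite rint_sum ?ler01//; last by move=> i _; apply: bmeas_sum => j _; exact: nn.
  apply: eq_bigr => i _; rewrite rint_sum ?ler01//.
  apply: eq_bigr => j _; rewrite rintZ ?ler01// ?rint_cos_cos//.
  by apply: bmeasM; exact: bmeas_cos_phase.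
rewrite mulr_suml; apply: eq_bigr => i _.
rewrite -[RHS](sum_delta R k i (fun j => al i * al j / 2)).
by apply: eq_bigr => j _; ring.
Qed.

(** Centred: [kdelta i j / 2] is the mean of the product of sines, because the frequencies are
    distinct and never opposite. *)
Definition sin_cov (i j : 'I_k) x : R :=
  sin (phase R n (m i) x) * sin (phase R n (m j) x) - kdelta i j / 2.

(** For general indices this depends on additive relations among four frequencies. Averaging over
    the sphere leaves only indices equal in pairs, for which the values are computed below. *)
Definition cov4 (i j l p : 'I_k) : R := I (fun x => sin_cov i j x * sin_cov l p x).

Lemma bmeas_sin_cov i j : bmeas (sin_cov i j).
Proof.
apply: bmeasB; last exact: bmeas_cst.
by apply: bmeasM; exact: bmeas_sin_phase.
Qed.

Lemma cos_double i x : cos (phase R n (m i + m i) x) =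
  1 - 2 * (sin (phase R n (m i) x) * sin (phase R n (m i) x)).
Proof.
have := cos2Dsin2 (phase R n (m i) x).
by rewrite phaseD cosD !expr2 => ?; lra.
Qed.

Lemma double_inj i j : (m i + m i == m j + m j) = (i == j).
Proof.
rewrite -m_inj; apply/eqP/eqP => [|->//] H; apply/rowP => r.
have := congr1 (fun v : 'rV_n => v 0 r) H; rewrite !mxE; lra.
Qed.

Lemma double_sum i j : m i + m i + (m j + m j) != 0.
Proof.
apply: contra (m_sum i j) => /eqP H; apply/eqP/rowP => r.
have := congr1 (fun v : 'rV_n => v 0 r) H; rewrite !mxE; lra.
Qed.

Let rint_double i j : I (fun x => cos (phase R n (m i + m i) x) *
  cos (phase R n (m j + m j) x)) = kdelta i j / 2.
Proof.
rewrite rint_cos_mul_cos//; try exact: int_vecD.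
rewrite double_inj (negbTE (double_sum i j)) addr0 mulrC !kdeltaE.
by case: (i == j).
Qed.

Let rint_double1 i : I (fun x => cos (phase R n (m i + m i) x)) = 0.
Proof. by rewrite rint_cos_phase ?(negbTE (m_sum i i))//; exact: int_vecD. Qed.

(** By [sin^2 = (1 - cos 2 phase) / 2] this is a correlation of two characters of doubled frequency,
    and doubling keeps frequencies distinct and never opposite. *)
Lemma cov4_diag i l : cov4 i i l l = kdelta i l / 8.
Proof.
transitivity (4^-1 * I (fun x => cos (phase R n (m i + m i) x) *
  cos (phase R n (m l + m l) x))).
  rewrite -rintZ ?ler01//; last by apply: bmeasM; exact: bmeas_cos_phase.
  by apply: eq_rint => // x _; rewrite !cos_double /sin_cov !kdeltaE !eqxx /=; field.
by rewrite rint_double; field.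
Qed.

Lemma cov4_offdiag i j : cov4 i j i j = 4^-1 - kdelta i j / 8.
Proof.
have [<-|ij] := eqVneq i j.
  by rewrite cov4_diag !kdeltaE eqxx /=; field.
pose D i x := cos (phase R n (m i + m i) x).
have nD i' : bmeas (D i') by exact: bmeas_cos_phase.
transitivity (I (fun x => 4^-1 * ((1 - D i x) - (D j x - D i x * D j x)))).
  apply: eq_rint => // x _; rewrite /D !cos_double /sin_cov !kdeltaE (negbTE ij) /=.
  by field.
have n1 : bmeas (fun x => 1 - D i x) by apply: bmeasB => //; exact: bmeas_cst.
have n2 : bmeas (fun x => D i x * D j x) by exact: bmeasM.
have n3 : bmeas (fun x => D j x - D i x * D j x) by exact: bmeasB.
rewrite rintZ ?ler01//; last exact: bmeasB.
rewrite !rintB ?ler01//; last exact: bmeas_cst.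
rewrite !rint_double1 rint_double rint_cst ?ler01// !subr0 expr1n.
by rewrite !kdeltaE (negbTE ij) /=; field.
Qed.

Lemma cov4_swap i j : cov4 i j j i = cov4 i j i j.
Proof.
apply: eq_rint => // x _; rewrite /sin_cov (_ : kdelta j i = kdelta i j); first ring.
by rewrite !kdeltaE eq_sym.
Qed.

(** The subtracted constant is the torus mean of [sqgrad a], so the products of sines appear
    centred. *)
Lemma grad_variance a : I (fun x => (sqgrad a x - (\sum_j a j ^+ 2 * eig j) / 2) ^+ 2) =
  (2 * pi) ^+ 4 * \sum_i \sum_j \sum_l \sum_p
    a i * a j * (a l * a p) * (gram i j * gram l p * cov4 i j l p).
Proof.
transitivity (I (fun x => (2 * pi) ^+ 4 * \sum_i \sum_j \sum_l \sum_p
    a i * a j * (a l * a p) * (gram i j * gram l p) * (sin_cov i j x * sin_cov l p x))).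
  apply: eq_rint => // x _.
  have -> : sqgrad a x - (\sum_j a j ^+ 2 * eig j) / 2 =
      (2 * pi) ^+ 2 * \sum_i \sum_j a i * a j * gram i j * sin_cov i j x.
    have -> : (\sum_j a j ^+ 2 * eig j) / 2 =
        (2 * pi) ^+ 2 * \sum_i \sum_j a i * a j * gram i j * (kdelta i j / 2).
      rewrite mulr_suml mulr_sumr; apply: eq_bigr => i _.
      rewrite (eq_bigr (fun j => kdelta i j * (a i * a j * gram i j / 2))); last first.
        by move=> j _; ring.
      by rewrite sum_delta /eig; ring.
    rewrite /sqgrad !grad_formE -mulrBr; congr (_ * _).
    rewrite -sumrB; apply: eq_bigr => i _; rewrite -sumrB; apply: eq_bigr => j _.
    by rewrite /sin_cov mulrBr.
  rewrite exprMn -exprM; congr (_ * _).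
  rewrite expr2 mulr_suml; apply: eq_bigr => i _.
  rewrite mulr_suml; apply: eq_bigr => j _.
  rewrite mulr_sumr; apply: eq_bigr => l _.
  rewrite mulr_sumr; apply: eq_bigr => p _; ring.
have nn i j l p : bmeas (fun x => a i * a j * (a l * a p) * (gram i j * gram l p) *
    (sin_cov i j x * sin_cov l p x)).
  by apply: bmeasZ; apply: bmeasM; exact: bmeas_sin_cov.
have n1 i j l : bmeas (fun x => \sum_p a i * a j * (a l * a p) * (gram i j * gram l p) *
    (sin_cov i j x * sin_cov l p x)) by apply: bmeas_sum.
have n2 i j : bmeas (fun x => \sum_l \sum_p a i * a j * (a l * a p) *
   (gram i j * gram l p) * (sin_cov i j x * sin_cov l p x)) by apply: bmeas_sum.
have n3 i : bmeas (fun x => \sum_j \sum_l \sum_p a i * a j * (a l * a p) *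
   (gram i j * gram l p) * (sin_cov i j x * sin_cov l p x)) by apply: bmeas_sum.
rewrite rintZ ?ler01//; last exact: bmeas_sum.
congr (_ * _); rewrite rint_sum ?ler01//; apply: eq_bigr => i _.
rewrite rint_sum ?ler01//; apply: eq_bigr => j _.
rewrite rint_sum ?ler01//; apply: eq_bigr => l _.
rewrite rint_sum ?ler01//; apply: eq_bigr => p _.
rewrite rintZ ?ler01// ?mulrA//.
by apply: bmeasM; exact: bmeas_sin_cov.
Qed.

End SecondMoments.
End TorusStein.

(** * Monotonicity of integrals of nonnegative functions *)

Section LowerIntegralMonotone.
Variable R : realType.
Notation mu := (@lebesgue_measure R).

(* No measurability is needed: the integral of a nonnegative function is the
   supremum of the integrals of the simple functions below it. *)
Lemma ge0_le_integral_nomeas (D : set R) (g1 g2 : R -> \bar R) :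
  (forall t, D t -> 0 <= g1 t)%E -> (forall t, D t -> g1 t <= g2 t)%E ->
  (\int[mu]_(t in D) g1 t <= \int[mu]_(t in D) g2 t)%E.
Proof.
move=> g10 g12.
have g20 t : (D t -> 0 <= g2 t)%E by move=> Dt; exact: le_trans (g10 t Dt) (g12 t Dt).
rewrite !ge0_integralE//; apply: le_ereal_sup => _ [h hg <-]; exists h => //= t.
apply: le_trans (hg t) _; rewrite !patchE; case: ifPn => // tD; apply: g12.
by rewrite inE in tD.
Qed.

(** To be applied with [g1] containing the total variation distance as a function of the
    coefficients. Nonnegativity is carried along because the one-dimensional comparison asks for it
    on each slice. *)
Lemma ge0_le_cube_int (a b : R) k (g1 g2 : (nat -> R) -> \bar R) :
  (forall x, incube R a b k x -> 0 <= g1 x)%E ->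
  (forall x, incube R a b k x -> g1 x <= g2 x)%E ->
  (0 <= cube_int a b k g1 <= cube_int a b k g2)%E.
Proof.
elim: k g1 g2 => [|k IH] g1 g2 g10 g12 /=; first by rewrite g10 ?g12.
have H t : a <= t <= b ->
    (0 <= cube_int a b k (fun x => g1 (Defs.ncons t x)) <=
     cube_int a b k (fun x => g2 (Defs.ncons t x)))%E.
  move=> tab; apply: IH => x xc; [apply: g10|apply: g12]; exact: incube_ncons.
apply/andP; split.
  by apply: integral_ge0 => t /=; rewrite in_itv/= => /H/andP[].
by apply: ge0_le_integral_nomeas => t /=; rewrite in_itv/= => /H/andP[].
Qed.

End LowerIntegralMonotone.

(** * Linearizing and recovering square roots *)

Section AMGM.
Variable R : realType.

Lemma normr_amgm (y c : R) : 0 < c -> 2 * `|y| <= y ^+ 2 / c + c.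
Proof.
move=> c0; rewrite -subr_ge0.
have -> : y ^+ 2 / c + c - 2 * `|y| = (`|y| - c) ^+ 2 / c.
  rewrite -[y ^+ 2]real_normK ?num_real//; field; exact: lt0r_neq0.
by rewrite divr_ge0 ?sqr_ge0// ltW.
Qed.

(** The optimal [c] is the root of [S]; for [S = 0] the infimum is only approached as [c] tends to
    0, which is why that case is separate. *)
Lemma lee_amgm_inf (E : \bar R) (A C S : R) : 0 <= C -> 0 <= S ->
  (forall c : R, (0 < c)%R -> E <= (A + C * (S / c + c))%:E)%E ->
  (E <= (A + C * (2 * Num.sqrt S))%:E)%E.
Proof.
move=> C0 S0 H; have [S0'|Sn] := eqVneq S 0.
  rewrite S0' sqrtr0 !mulr0 addr0; apply/lee_addgt0Pr => e e0.
  have C1 : 0 < C + 1 by rewrite ltr_wpDl.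
  apply: (le_trans (H (e / (C + 1)) (divr_gt0 e0 C1))).
  rewrite S0' mul0r add0r -EFinD lee_fin lerD2l mulrCA ger_pMr//.
  by rewrite ler_pdivrMr// mul1r lerDl.
have s0 : 0 < Num.sqrt S by rewrite sqrtr_gt0 lt_neqAle eq_sym Sn.
apply: (le_trans (H _ s0)); rewrite lee_fin lerD2l ler_wpM2l//.
rewrite -{1}[S]sqr_sqrtr// expr2 mulfK ?lt0r_neq0//; lra.
Qed.

End AMGM.

(** * The majorant in the coefficients and its average over the sphere *)

Section Assembly.
Variables (R : realType) (n k : nat) (m w : 'I_k -> 'rV[R]_n).
Hypothesis mZ : forall j, int_vec R n (m j).
Hypothesis m_inj : forall i j, (m i == m j) = (i == j).
Hypothesis m_sum : forall i j, m i + m j != 0.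
Notation G := (gram R n k m w).
Notation mu_ := (eig R n k m w).
Notation cov4 := (cov4 R n k m).
Notation cos_sum := (cos_sum R n k m).
Notation kdelta := (kdelta R k).
Notation qform := (qform R k).
Notation J := (rint R (-1) 1 k).
Hypothesis GC : forall i j, G i j = G j i.
Variables tau c1 c2 : R.
Hypotheses (tau0 : 0 < tau) (c10 : 0 < c1) (c20 : 0 < c2).

Let K i j l p := G i j * G l p * cov4 i j l p.
(** The first term is two halves: one from the second moment of the Laplacian error, one from the
    distance between [tau] and the mean of [sqgrad]. The latter also brings [c2 / 2]. *)
Let beta j := (mu_ j - tau) ^+ 2 / c2 + c2 / 2.

(** [q i j] stands for [a i * a j], later for [2 * qform i j x]. The absolute value is 0 when
    [|a|^2 = 2]; it makes the bound valid for every [a], in particular for [a = 0]. *)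
Definition tv_majorant (q : 'I_k -> 'I_k -> R) : R :=
  (2 * pi) ^+ 4 / c1 * (\sum_i \sum_j \sum_l \sum_p q i j * q l p * K i j l p)
  + c1 + \sum_j q j j * beta j + 2 * tau * `|1 - (\sum_j q j j) / 2| + c2.

Lemma dTV_torus_le (a : 'I_k -> R) :
  (dTV (fun A => torus_prob n [set x | cos_sum a x \in A]) (normal_prob 0 1)
   <= (tau^-1 * tv_majorant (fun i j => a i * a j))%:E)%E.
Proof.
apply: dTV_normal_le; first by case: (bmeas_cos_sum R n k m a).
move=> h ch h01.
apply: le_trans (stein_torus_bound _ _ _ _ w mZ a tau h tau0 ch h01) _.
rewrite ler_pM2l ?invr_gt0//.
have n01 : 0 <= 1 :> R by exact: ler01.
(* [M] is the torus mean of [sqgrad], so [X] is its fluctuation. *)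
pose M := (\sum_j a j ^+ 2 * mu_ j) / 2.
pose e := cos_sum (fun j => a j * (mu_ j - tau)).
pose X x := sqgrad R n k m w a x - M.
have nX : bounded_meas R 0 1 n X.
  by apply: bmeasB; [exact: bmeas_sqgrad|exact: bmeas_cst].
have nX2 := bmeasX _ _ _ _ 2 _ nX.
have ne : bounded_meas R 0 1 n e by exact: bmeas_cos_sum.
have ne2 := bmeasX _ _ _ _ 2 _ ne.
have H1 : 2 * rint R 0 1 n (fun x => `|sqgrad R n k m w a x - tau|) <=
    c1^-1 * rint R 0 1 n (fun x => X x ^+ 2) + (c1 + 2 * `|M - tau|).
  rewrite -!rintZ//; last exact: bmeas_sqgrad_dist.
  rewrite [X in _ <= _ + X](_ : _ = rint R 0 1 n (fun=> c1 + 2 * `|M - tau|)); last first.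
    by rewrite rint_cst// subr0 expr1n mulr1.
  have nc := bmeas_cst R 0 1 n (c1 + 2 * `|M - tau|).
  have nZ := bmeasZ _ _ _ _ c1^-1 _ nX2.
  rewrite -rintD//; apply: le_rint => //.
  - by apply: bmeasZ; exact: bmeas_sqgrad_dist.
  - exact: bmeasD.
  move=> x _; have := normr_amgm R (X x) c1 c10.
  have : `|sqgrad R n k m w a x - tau| <= `|X x| + `|M - tau|.
    by rewrite (le_trans _ (ler_normD _ _))// /X addrA subrK.
  rewrite [X x ^+ 2 / c1]mulrC; lra.
have H2 : 2 * rint R 0 1 n (fun x => `|e x|) <=
    c2^-1 * rint R 0 1 n (fun x => e x ^+ 2) + c2.
  rewrite -!rintZ//; last exact: bounded_meas_norm.
  rewrite [X in _ <= _ + X](_ : _ = rint R 0 1 n (fun=> c2)); last first.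
    by rewrite rint_cst// subr0 expr1n mulr1.
  have nc := bmeas_cst R 0 1 n c2.
  have nZ := bmeasZ _ _ _ _ c2^-1 _ ne2.
  rewrite -rintD//; apply: le_rint => //.
  - by apply: bmeasZ; exact: bounded_meas_norm.
  - exact: bmeasD.
  move=> x _; have := normr_amgm R (e x) c2 c20.
  by rewrite [e x ^+ 2 / c2]mulrC.
(* [M - tau] is estimated term by term with the same [c2] as the Laplacian error; the defect
   accounts for weights [a j ^+ 2 / 2] that need not sum to 1. *)
have H3 : 2 * `|M - tau| <= (\sum_j a j ^+ 2 * ((mu_ j - tau) ^+ 2 / c2 + c2)) / 2
    + 2 * tau * `|1 - (\sum_j a j ^+ 2) / 2|.
  have -> : M - tau = (\sum_j a j ^+ 2 * (mu_ j - tau)) / 2 -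
      tau * (1 - (\sum_j a j ^+ 2) / 2).
    rewrite /M; under [in RHS]eq_bigr do rewrite mulrBr.
    by rewrite sumrB -mulr_suml; field.
  have : `|(\sum_j a j ^+ 2 * (mu_ j - tau)) / 2| * 2 <=
      (\sum_j a j ^+ 2 * ((mu_ j - tau) ^+ 2 / c2 + c2)) / 2.
    rewrite normrM (ger0_norm (_ : 0 <= 2^-1)); last by rewrite invr_ge0.
    rewrite mulfVK// ler_pdivlMr// mulrC.
    rewrite -ler_pdivlMl//.
    apply: le_trans (ler_norm_sum _ _ _) _.
    rewrite mulr_sumr; apply: ler_sum => j _.
    rewrite normrM (ger0_norm (sqr_ge0 _)) mulrCA ler_wpM2l ?sqr_ge0//.
    by rewrite ler_pdivlMl//; exact: normr_amgm.
  have := ler_normB ((\sum_j a j ^+ 2 * (mu_ j - tau)) / 2)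
    (tau * (1 - (\sum_j a j ^+ 2) / 2)).
  rewrite [X in _ <= _ + X]normrM (ger0_norm (ltW tau0)).
  lra.
have E1 : rint R 0 1 n (fun x => X x ^+ 2) = (2 * pi) ^+ 4 * \sum_i \sum_j \sum_l \sum_p
    a i * a j * (a l * a p) * K i j l p.
  exact: grad_variance.
have E2 : rint R 0 1 n (fun x => e x ^+ 2) = (\sum_j (a j * (mu_ j - tau)) ^+ 2) / 2.
  exact: rint_cos_sum_sqr.
apply: (le_trans (lerD H1 H2)); rewrite E1 E2 /tv_majorant.
have -> : \sum_j a j * a j * beta j =
    (\sum_j a j ^+ 2 * ((mu_ j - tau) ^+ 2 / c2 + c2)) / 2 +
    c2^-1 * ((\sum_j (a j * (mu_ j - tau)) ^+ 2) / 2).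
  rewrite mulr_suml mulr_suml mulr_sumr -big_split/=; apply: eq_bigr => j _.
  rewrite /beta; field; exact: lt0r_neq0.
have -> : \sum_j a j * a j = \sum_j a j ^+ 2 by apply: eq_bigr => j _; rewrite expr2.
rewrite [(2 * pi) ^+ 4 / c1 * _]mulrAC [_ * c1^-1]mulrC.
lra.
Qed.

(** The three pairings contribute [cov4 i i l l], [cov4 i j i j] and [cov4 i j j i]. The exact value
    is the right side minus one eighth of the sum of [G i i ^+ 2]. *)
Lemma sum_covariance : \sum_i \sum_j \sum_l \sum_p K i j l p *
    (kdelta i j * kdelta l p + kdelta i l * kdelta j p + kdelta i p * kdelta j l) <=
  (\sum_i \sum_j G i j ^+ 2) / 2.
Proof.
rewrite mulr_suml; apply: ler_sum => i _.
have E j l : \sum_p K i j l p *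
    (kdelta i j * kdelta l p + kdelta i l * kdelta j p + kdelta i p * kdelta j l) =
    kdelta i j * K i j l l + kdelta i l * K i j l j + kdelta j l * K i j l i.
  rewrite -(sum_delta R k l (fun p => kdelta i j * K i j l p)).
  rewrite -(sum_delta R k j (fun p => kdelta i l * K i j l p)).
  rewrite -(sum_delta R k i (fun p => kdelta j l * K i j l p)).
  by rewrite -!big_split/=; apply: eq_bigr => p _; ring.
have E' j : \sum_l \sum_p K i j l p *
    (kdelta i j * kdelta l p + kdelta i l * kdelta j p + kdelta i p * kdelta j l) =
    kdelta i j * (\sum_l K i i l l) + (K i j i j + K i j j i).
  rewrite (eq_bigr _ (fun l _ => E j l)) !big_split/= sum_delta sum_delta addrA.
  congr (_ + _ + _); rewrite mulr_sumr; apply: eq_bigr => l _.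
  by rewrite !kdeltaE; case: eqVneq => [<-//|_]; rewrite !mul0r.
rewrite (eq_bigr _ (fun j _ => E' j)) big_split/= sum_delta.
have -> : \sum_l K i i l l = G i i ^+ 2 / 8.
  rewrite -(sum_delta R k i (fun l => G i i * G l l / 8)).
  by apply: eq_bigr => l _; rewrite /K cov4_diag//; ring.
have -> : \sum_j (K i j i j + K i j j i) =
    (\sum_j G i j ^+ 2) / 2 - G i i ^+ 2 / 4.
  rewrite -(sum_delta R k i (fun j => G i j ^+ 2 / 4)) mulr_suml -sumrB.
  by apply: eq_bigr => j _; rewrite /K cov4_swap cov4_offdiag// (GC j i); field.
have := sqr_ge0 (G i i); lra.
Qed.

Notation ball_ind := (ball_ind R k).
Notation ball_vol := (ball_vol R k).

Definition tv_bound : R :=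
  2 * (2 * pi) ^+ 4 / (k%:R * (k%:R + 2)) * (\sum_i \sum_j G i j ^+ 2) / c1 + c1
  + 2 * (k%:R^-1 * (\sum_j (mu_ j - tau) ^+ 2) / c2 + c2).

Let N11 : -1 <= 1 :> R. Proof. lra. Qed.

Lemma ball_vol_ge0 : 0 <= ball_vol.
Proof.
by apply: rint_ge0 => x _; rewrite !ball_indE /ind_le; case: ifP => _; rewrite ?ler01.
Qed.

Lemma bmeas_ball_majorant : bounded_meas R (-1) 1 k
  (fun x => ball_ind x * tv_majorant (fun i j => 2 * qform i j x)).
Proof.
have nq i j : bounded_meas R (-1) 1 k (fun x => 2 * qform i j x).
  by apply: bmeasZ; exact: bmeas_qform.
apply: bmeasM; first exact: bmeas_ball_ind.
apply: bmeasD; last exact: bmeas_cst.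
apply: bmeasD; last first.
  apply: bmeasZ; apply: bounded_meas_norm; apply: bmeasB; first exact: bmeas_cst.
  by apply: bmeasM; [exact: bmeas_sum|exact: bmeas_cst].
apply: bmeasD; last by apply: bmeas_sum => j _; apply: bmeasM => //; exact: bmeas_cst.
apply: bmeasD; last exact: bmeas_cst.
apply: bmeasZ; do 4 (apply: bmeas_sum => ? _); apply: bmeasM; last exact: bmeas_cst.
exact: bmeasM.
Qed.

Lemma rint_ball_majorant : (0 < k)%N ->
  J (fun x => ball_ind x * tv_majorant (fun i j => 2 * qform i j x)) <=
  ball_vol * tv_bound.
Proof.
move=> k0.
have nb := bmeas_ball_ind R k.
have nbq i j : bounded_meas R (-1) 1 k (fun x => ball_ind x * qform i j x).
  by apply: bmeasM => //; exact: bmeas_qform.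
have nbo : bounded_meas R (-1) 1 k (fun x => ball_ind x * origin_ind R k x).
  by apply: bmeasM => //; exact: bmeas_origin_ind.
have n4 i j l p := bmeas_moment4 R k i j l p.
pose f4 x := \sum_i \sum_j \sum_l \sum_p K i j l p *
  (ball_ind x * (qform i j x * qform l p x)).
pose f2 x := \sum_j beta j * (ball_ind x * qform j j x).
have nf4 : bounded_meas R (-1) 1 k f4.
  by do 4 (apply: bmeas_sum => ? _); exact: bmeasZ.
have nf2 : bounded_meas R (-1) 1 k f2 by apply: bmeas_sum => j _; exact: bmeasZ.
have nZ c g : bounded_meas R (-1) 1 k g -> bounded_meas R (-1) 1 k (fun x => c * g x).
  exact: bmeasZ.
have nD g h : bounded_meas R (-1) 1 k g -> bounded_meas R (-1) 1 k h ->
    bounded_meas R (-1) 1 k (fun x => g x + h x) by exact: bmeasD.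
(* The factor 4 comes from the product of two entries [2 * qform]. *)
set A := (2 * pi) ^+ 4 / c1 * 4.
rewrite [leLHS](_ : _ = J (fun x => A * f4 x + ((c1 + c2) * ball_ind x + (2 * f2 x +
    2 * tau * (ball_ind x * origin_ind R k x))))); last first.
  apply: eq_rint => // x _.
  rewrite /tv_majorant.
  (* On the sphere parametrized by the ball the defect is the indicator of the origin, whose
     integral is 0. *)
  have -> : 1 - (\sum_j 2 * qform j j x) / 2 = origin_ind R k x.
    by rewrite -mulr_sumr /origin_ind; field.
  rewrite ger0_norm; last by rewrite origin_indE; case: ifP => _; rewrite ?ler01.
  have -> : \sum_i \sum_j \sum_l \sum_p 2 * qform i j x * (2 * qform l p x) * K i j l p =
      4 * \sum_i \sum_j \sum_l \sum_p qform i j x * qform l p x * K i j l p.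
    do 4 (rewrite mulr_sumr; apply: eq_bigr => ? _); ring.
  have -> : f4 x = ball_ind x *
      \sum_i \sum_j \sum_l \sum_p qform i j x * qform l p x * K i j l p.
    do 4 (rewrite mulr_sumr; apply: eq_bigr => ? _); ring.
  have -> : \sum_j 2 * qform j j x * beta j = 2 * \sum_j qform j j x * beta j.
    by rewrite mulr_sumr; apply: eq_bigr => j _; ring.
  have -> : f2 x = ball_ind x * \sum_j qform j j x * beta j.
    by rewrite mulr_sumr; apply: eq_bigr => j _; ring.
  by rewrite /A; ring.
have nA := nZ A _ nf4; have nb' := nZ (c1 + c2) _ nb; have nf2' := nZ 2 _ nf2.
have no := nZ (2 * tau) _ nbo; have nD1 := nD _ _ nf2' no.
have nD2 := nD _ _ nb' nD1.
rewrite !rintD ?rintZ//.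
rewrite rint_origin_ind// mulr0 addr0 -/ball_vol.
have -> : J f4 = ball_vol / (k%:R * (k%:R + 2)) *
    \sum_i \sum_j \sum_l \sum_p K i j l p * (kdelta i j * kdelta l p +
      kdelta i l * kdelta j p + kdelta i p * kdelta j l).
  rewrite /f4; do 4 (rewrite rint_sum//; [rewrite mulr_sumr; apply: eq_bigr => ? _|
    by move=> *; repeat (apply: bmeas_sum; move=> ? _); exact: nZ]).
  by rewrite rintZ// -/(moment4 R k _ _ _ _) moment4E; ring.
have -> : J f2 = ball_vol / k%:R * \sum_j beta j.
  rewrite /f2 rint_sum//; last by move=> j _; exact: nZ.
  rewrite mulr_sumr; apply: eq_bigr => j _.
  by rewrite rintZ// moment2E !kdeltaE eqxx /=; ring.
have kR : 0 < k%:R :> R by rewrite ltr0n.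
have -> : \sum_j beta j = (\sum_j (mu_ j - tau) ^+ 2) / c2 + k%:R * (c2 / 2).
  by rewrite /beta big_split/= sumr_const card_ord -mulr_suml [k%:R * _]mulr_natl.
set Sg := \sum_i \sum_j \sum_l _; set SG := \sum_i \sum_j G i j ^+ 2.
have SgG : Sg <= SG / 2 := sum_covariance.
set T := \sum_j _.
have -> : ball_vol * tv_bound = A * (ball_vol / (k%:R * (k%:R + 2)) * (SG / 2)) +
    ((c1 + c2) * ball_vol + 2 * (ball_vol / k%:R * (T / c2 + k%:R * (c2 / 2)))).
  rewrite /tv_bound -/SG -/T /A; field.
  by rewrite !gt_eqF// addr_gt0.
rewrite lerD2r ler_wpM2l//.
  by rewrite /A mulr_ge0// divr_ge0 ?exprn_even_ge0// ltW.
by rewrite ler_wpM2l// divr_ge0 ?ball_vol_ge0// mulr_ge0// ltW// addr_gt0.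
Qed.

Lemma tv_bound_ge0 : 0 <= tv_bound.
Proof.
have kR : 0 <= k%:R :> R by rewrite ler0n.
apply: addr_ge0.
  apply: addr_ge0; last exact: ltW.
  apply: divr_ge0; last exact: ltW.
  apply: mulr_ge0.
    apply: divr_ge0; last by rewrite mulr_ge0 ?addr_ge0.
    by rewrite mulr_ge0 ?exprn_even_ge0.
  by do 2 (apply: sumr_ge0 => ? _); exact: sqr_ge0.
apply: mulr_ge0 => //; apply: addr_ge0; last exact: ltW.
apply: divr_ge0; last exact: ltW.
rewrite mulr_ge0 ?invr_ge0//; apply: sumr_ge0 => j _; exact: sqr_ge0.
Qed.

Lemma sphere_indicE (x : nat -> R) :
  \1_[set y | eucl_norm k y <= 1] x = ball_ind x :> R.
Proof.
rewrite indicE !ball_indE /ind_le.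
have -> : (sqnorm R k x <= 1) = (eucl_norm k x <= 1).
  by rewrite /eucl_norm -[in RHS](sqrtr1 R) ler_sqrt.
case: ifPn => H; first by rewrite mem_set.
by rewrite memNset//; exact/negP.
Qed.

Lemma sphere_expect_le (F : (nat -> R) -> \bar R) : (0 < k)%N ->
  (forall a, 0 <= F a)%E ->
  (forall a, F a <= (tau^-1 * tv_majorant (fun i j => a i * a j))%R%:E)%E ->
  (sphere_expect k (Num.sqrt 2) F <= (tau^-1 * tv_bound)%:E)%E.
Proof.
move=> k0 F0 FM; rewrite /sphere_expect.
have bE : (fun x => (\1_[set y | eucl_norm k y <= 1] x)%:E) =
    (fun x => (ball_ind x)%:E).
  by apply/funext => x; rewrite sphere_indicE.
have b01 x : 0 <= ball_ind x.
  by rewrite !ball_indE /ind_le; case: ifP => _; rewrite ?ler01.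
rewrite bE -/ball_vol.
have nM := bmeasZ _ _ _ _ tau^-1 _ bmeas_ball_majorant.
(* At [a = sqrt 2 * x / |x|] the products [a i * a j] equal [2 * qform i j x], at the origin too
   since both are then 0. *)
apply: (@le_trans _ _ ((J (fun x => tau^-1 * (ball_ind x *
    tv_majorant (fun i j => 2 * qform i j x)))) %:E * (ball_vol^-1)%:E)%E).
  apply: lee_wpmul2r; first by rewrite lee_fin invr_ge0 ball_vol_ge0.
  rewrite -cube_int_rint//.
  set g1 := (g in (cube_int _ _ _ g <= _)%E).
  set g2 := (g in (_ <= cube_int _ _ _ g)%E).
  suff : (0 <= cube_int (-1) 1 k g1 <= cube_int (-1) 1 k g2)%E by case/andP.
  apply: ge0_le_cube_int.
  - by move=> x _; rewrite /g1 sphere_indicE mule_ge0// lee_fin.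
  - move=> x _; rewrite /g1 /g2 sphere_indicE mulrCA EFinM; apply: lee_wpmul2l.
      by rewrite lee_fin.
    apply: le_trans (FM _) _; rewrite lee_fin le_eqVlt; apply/orP; left; apply/eqP.
    congr (_ * tv_majorant _); apply/funext => i; apply/funext => j.
    have N2 : (eucl_norm k x)^-1 * (eucl_norm k x)^-1 = (sqnorm R k x)^-1.
      rewrite -expr2 exprVn sqr_sqrtr//; exact: sqnorm_ge0.
    have S2 : Num.sqrt 2 * Num.sqrt 2 = 2 :> R by rewrite -expr2 sqr_sqrtr.
    rewrite !qformE -N2 -[in RHS]S2; ring.
rewrite -EFinM lee_fin rintZ//; last exact: bmeas_ball_majorant.
rewrite -mulrA ler_pM2l ?invr_gt0//.
(* With [0^-1 = 0], volume 0 would make the left side 0, and [tv_bound_ge0] settles that case. *)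
have [v0|v0] := eqVneq ball_vol 0; first by rewrite v0 invr0 mulr0 tv_bound_ge0.
have vp : 0 < ball_vol by rewrite lt_neqAle eq_sym v0 ball_vol_ge0.
by rewrite ler_pdivrMr// mulrC rint_ball_majorant.
Qed.

End Assembly.

Lemma dTV_ge0 (R : realType) (P Q : set R -> \bar R) : (0 <= dTV P Q)%E.
Proof.
apply: le_trans (abse_ge0 (P set0 - Q set0)%E) _.
by apply: ereal_sup_ubound; exists set0 => //=; exact: measurable0.
Qed.

Theorem theorem4p1 (R : realType) (n : nat) (B : 'M[R]_n)
  (V : seq 'rV[R]_n) (mu : R) :
  B^T = B ->
  (forall x : 'rV[R]_n, x != 0 -> 0 < innerB B x x) ->
  uniq V -> (0 < size V)%N ->
  (forall v, v \in V -> forall i : 'I_n, exists z : int, (v *m B) 0 i = z%:~R) ->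
  (forall v w, v \in V -> w \in V -> v + w != 0) ->
  0 < mu ->
  (sphere_expect (size V) (Num.sqrt 2)
     (fun a => dTV (fun A => torus_prob n [set x | randf B V a x \in A])
                   (normal_prob 0 1))
   <= (mu^-1 *
       (Num.sqrt (8 * (2 * pi) ^+ 4 / ((size V)%:R * ((size V)%:R + 2)) *
                  \sum_(v <- V) \sum_(w <- V) innerB B v w ^+ 2)
        + (2 * Num.sqrt 2 + Num.sqrt pi) *
          Num.sqrt ((size V)%:R^-1 * \sum_(v <- V) (eigB B v - mu) ^+ 2)))%:E)%E.
Proof.
move=> BT Bpos uV k0 VZ V0 mu0; set k := size V in k0 *.
pose w (j : 'I_k) : 'rV[R]_n := V`_j; pose m j := w j *m B.
have wV j : w j \in V by exact: mem_nth.
(* Injectivity of [B], from positive definiteness, carries distinctness and the absence of opposite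
   pairs from [V] to the frequencies [m]. *)
have Binj (u : 'rV[R]_n) : u *m B = 0 -> u = 0.
  move=> uB; apply/eqP; apply: contraT => /Bpos.
  by rewrite /innerB uB mul0mx mxE ltxx.
have mZ j : int_vec R n (m j) by move=> i; exact: VZ.
have m_inj i j : (m i == m j) = (i == j).
  apply/eqP/eqP => [H|->//]; apply/val_inj/eqP.
  rewrite -(nth_uniq 0 (ltn_ord i) (ltn_ord j) uV) -subr_eq0; apply/eqP/Binj.
  by rewrite mulmxBl; apply/eqP; rewrite subr_eq0; apply/eqP.
have m_sum i j : m i + m j != 0.
  rewrite -mulmxDl; apply: contra (V0 _ _ (wV i) (wV j)) => /eqP/Binj H.
  exact/eqP.
have gramE i j : gram R n k m w i j = innerB B (w i) (w j).
  by rewrite /innerB mxE; apply: eq_bigr => r _; rewrite [_^T _ _]mxE.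
have GC i j : gram R n k m w i j = gram R n k m w j i.
  rewrite !gramE /innerB.
  have -> : w i *m B *m (w j)^T = (w j *m B *m (w i)^T)^T.
    by rewrite !trmx_mul trmxK BT mulmxA.
  by rewrite [LHS]mxE.
have eigE j : eig R n k m w j = eigB B (w j) by rewrite /eig gramE.
have -> : \sum_(v <- V) \sum_(w <- V) innerB B v w ^+ 2 =
    \sum_i \sum_j gram R n k m w i j ^+ 2.
  rewrite (big_nth 0) big_mkord; apply: eq_bigr => i _.
  by rewrite (big_nth 0) big_mkord; apply: eq_bigr => j _; rewrite gramE.
have -> : \sum_(v <- V) (eigB B v - mu) ^+ 2 = \sum_j (eig R n k m w j - mu) ^+ 2.
  by rewrite (big_nth 0) big_mkord; apply: eq_bigr => j _; rewrite eigE.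
set SG := \sum_i \sum_j _; set ST := \sum_j _.
have SG0 : 0 <= SG by do 2 (apply: sumr_ge0 => ? _); exact: sqr_ge0.
have ST0 : 0 <= ST by apply: sumr_ge0 => ? _; exact: sqr_ge0.
have kR : 0 < k%:R :> R by rewrite ltr0n.
set E := sphere_expect _ _ _.
have bound c1 c2 : 0 < c1 -> 0 < c2 ->
    (E <= (mu^-1 * tv_bound R n k m w mu c1 c2)%:E)%E.
  move=> c10 c20; apply: sphere_expect_le => //.
    by move=> a; exact: dTV_ge0.
  by move=> a; exact: (dTV_torus_le R n k m w mZ m_inj m_sum mu c1 c2 mu0 c10 c20).
pose S := 2 * (2 * pi) ^+ 4 / (k%:R * (k%:R + 2)) * SG; pose T := k%:R^-1 * ST.
have S0 : 0 <= S.
  apply: mulr_ge0 => //; apply: divr_ge0; last by rewrite mulr_ge0 ?addr_ge0// ltW.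
  by rewrite mulr_ge0 ?exprn_even_ge0.
have T0 : 0 <= T by apply: mulr_ge0 => //; rewrite invr_ge0 ltW.
have mV0 : 0 <= mu^-1 by rewrite invr_ge0 ltW.
(* The parameters are optimized one after the other: [c1] here, [c2] in [bound2]. *)
have bound1 c2 : 0 < c2 ->
    (E <= (mu^-1 * (2 * (T / c2 + c2)) + mu^-1 * (2 * Num.sqrt S))%:E)%E.
  move=> c20; apply: lee_amgm_inf => // c c0.
  apply: le_trans (bound c c2 c0 c20) _; rewrite lee_fin /tv_bound -/SG -/ST.
  by rewrite -/S -/T -mulrDr addrC.
have bound2 : (E <= (mu^-1 * (2 * Num.sqrt S) + (mu^-1 * 2) * (2 * Num.sqrt T))%:E)%E.
  apply: lee_amgm_inf => //; first by rewrite mulr_ge0.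
  by move=> c c0; apply: le_trans (bound1 c c0) _; rewrite lee_fin addrC mulrA.
apply: le_trans bound2 _; rewrite lee_fin -mulrA -mulrDr ler_wpM2l//.
apply: lerD.
  (* The first root is exactly the root of [4 * S]; nothing is lost in this term. *)
  have -> : 8 * (2 * pi) ^+ 4 / (k%:R * (k%:R + 2)) * SG = 2 ^+ 2 * S.
    by rewrite /S; field; rewrite !gt_eqF// addr_gt0.
  by rewrite (sqrtrM S (sqr_ge0 2)) sqrtr_sqr ger0_norm.
rewrite mulrA ler_wpM2r ?sqrtr_ge0//.
have s2 : Num.sqrt 2 ^+ 2 = 2 :> R by rewrite sqr_sqrtr.
(* It remains to see that 4 is at most [2 * sqrt 2 + sqrt pi], which is at least [3 * sqrt 2]. *)
have sp : Num.sqrt 2 <= Num.sqrt pi :> R by rewrite ler_sqrt ?pi_ge0// pi_ge2.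
have : 0 <= Num.sqrt 2 :> R by exact: sqrtr_ge0.
move: s2 sp; nra.
Qed.
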